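(* (a) Suppose that the step sizes $\{\alpha_t\}_{t\ge0}$ are non-increasing with $0\le\alpha_\tau\le\min\{1,1/\widehat\mu_1\}$ for all $\tau\ge0$, that $\eta_t\to\infty$ as $t\to\infty$, and that for $0\le t_1\ll t_2$ as $t_2\to\infty$, $\eta_{t_1}\ll\eta_{t_2}$. Suppose also that $\kappa_t=\min\{j:\mu_j<1/\eta_t\}-1$ satisfies $\kappa_t\to\infty$ as $t\to\infty$. For any $\varepsilon>0$ there exist positive constants $C_\varepsilon$, $t_\varepsilon$ and $N_\varepsilon$ such that, with probability greater than $1-e^{-c\kappa_t}$, $$\inf_{t\ge t_\varepsilon}\ \inf_{n\ge N_\varepsilon}\ \inf_{\substack{f\in\mathcal{B}\\ \|f\|_n\ge C_\varepsilon d_{n,t}}}P_f(\phi_{n,t}=1\mid\boldsymbol{x})\ \ge\ 1-\varepsilon,$$ where $c$ is a constant, $\mathcal{B}=\{f\in\mathcal{H}:\|f\|_{\mathcal{H}}\le C\}$ for a constant $C$, and $P_f(\cdot)$ is the probability measure under $f$. (b) The separation rate $d_{n,t}$ achieves its minimal value as $d_n^*:=d_{n,T^*}$, i.e. at $t=T^*$.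
   Context: Model: $y_i=f(x_i)+\epsilon_i$, $i=1,\dots,n$, where $x_i\in\mathcal{X}\subset\mathbb{R}^d$ ($d\ge1$ fixed) are i.i.d. random covariates with distribution $P_X$, and the $\epsilon_i$ are i.i.d. Gaussian noise, independent of the covariates, with mean zero and variance $\sigma^2=1$. Write $\boldsymbol{x}=(x_1,\dots,x_n)$, $\boldsymbol{y}=(y_1,\dots,y_n)^\top$. The function $f$ lies in a reproducing kernel Hilbert space $\mathcal{H}\subset L^2(P_X)$ with reproducing kernel $K$ having Mercer expansion $K(x,x')=\sum_{i\ge1}\mu_i\phi_i(x)\phi_i(x')$, $\mu_1\ge\mu_2\ge\cdots\ge0$, with $\langle\phi_i,\phi_j\rangle_{L^2(P_X)}=\delta_{ij}$ and $\langle\phi_i,\phi_j\rangle_{\mathcal{H}}=\delta_{ij}/\mu_i$. Assumed throughout: there is a finite constant $c_K>0$ with $\sup_{j}\|\phi_j\|_{\sup}\le c_K$. Empirical norm: $\|f\|_n^2=\frac1n\sum_{i=1}^nf(x_i)^2$. Empirical kernel matrix: $[\boldsymbol{K}]_{ij}=\frac1nK(x_i,x_j)$, $\boldsymbol{K}=U\Lambda U^\top$, $UU^\top=I_n$, $\Lambda=\operatorname{diag}(\widehat\mu_1,\dots,\widehat\mu_n)$, $\widehat\mu_1\ge\cdots\ge\widehat\mu_n\ge0$. Gradient descent: with step sizes $\{\alpha_t\}_{t\ge0}$, $\boldsymbol{f}_{t}=(f_t(x_1),\dots,f_t(x_n))^\top$ satisfies $\boldsymbol{f}_{t+1}=\boldsymbol{f}_t-\alpha_t\boldsymbol{K}(\boldsymbol{f}_t-\boldsymbol{y})$,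 with $\boldsymbol{f}_0=0$. Total step size: $\eta_t=\sum_{\tau=0}^{t-1}\alpha_\tau$. Shrinkage matrices: $S^t=\prod_{\tau=0}^{t-1}(I_n-\alpha_\tau\Lambda)$. Here $a\ll b$ means $a/b\to0$. Testing $H_0:f=0$ against $H_1:f\in\mathcal{H}\setminus\{0\}$: the statistic is $D_{n,t}=\|f_t\|_n^2$; $\mu_{n,t}=\frac1n\operatorname{tr}((I_n-S^t)^2)$, $\sigma_{n,t}^2=\frac2{n^2}\operatorname{tr}((I_n-S^t)^4)$ are its conditional mean and variance given $\boldsymbol{x}$ under $H_0$; the test at significance level $\alpha$ is $\phi_{n,t}=I(|D_{n,t}-\mu_{n,t}|\ge z_{1-\alpha/2}\sigma_{n,t})$, with $z_{1-\alpha/2}$ the $100(1-\alpha/2)$th percentile of the standard normal distribution. Squared separation rate: $d_{n,t}^2=\frac1{\eta_t}+\sigma_{n,t}$, which the paper considers up to order, with $d_{n,t}^2\asymp\frac1{\eta_t}+\frac1n\sqrt{\sum_{i=1}^n\min\{1,\eta_t\widehat\mu_i\}}$ ($\asymp$: equality up to positive multiplicative constants). Stopping rule: $$T^*=\min\Big\{t\in\mathbb{N}:\ \frac1{\eta_t}<\frac{\sigma}{n}\sqrt{\textstyle\sum_{i=1}^n\min\{1,\eta_t\widehat\mu_i\}}\Big\}.$$ The phrase ''with probability'' refers to the randomness of $\boldsymbol{x}$. *)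

(* Defs.v *)
From HB Require Import structures.
From mathcomp Require Import all_boot all_order all_algebra.
From mathcomp Require Import all_classical all_reals all_analysis.

Set Implicit Arguments.
Unset Strict Implicit.
Unset Printing Implicit Defensive.

Import Order.TTheory GRing.Theory Num.Theory.
Import numFieldNormedType.Exports.

Local Open Scope classical_set_scope.
Local Open Scope ring_scope.

Definition is_minimum (A : set nat) (k : nat) : Prop :=
  A k /\ forall j, A j -> (k <= j)%N.

Section Kernel_space.
Context {R : realType} {d : nat}.
Local Notation E := (d.-tuple R).

Definition rkhs_norm (ip : (E -> R) -> (E -> R) -> R) (f : E -> R) : R :=
  Num.sqrt (ip f f).

(* A function on the covariate space XX is encoded by its extension by 0 to
   R^d (field rkhs_supp), so that Leibniz equality of members of H is equality
   of functions on XX. *)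
Record is_rkhs (XX : set E) (K : E -> E -> R) (H : set (E -> R))
    (ip : (E -> R) -> (E -> R) -> R) : Prop := {
  rkhs_supp : forall f, H f -> forall x, ~ XX x -> f x = 0;
  rkhs_zero : H (fun=> 0);
  rkhs_lin : forall (a : R) f g, H f -> H g -> H (fun x => a * f x + g x);
  rkhs_ip_sym : forall f g, H f -> H g -> ip f g = ip g f;
  rkhs_ip_lin : forall (a : R) f g h, H f -> H g -> H h ->
    ip (fun x => a * f x + g x) h = a * ip f h + ip g h;
  rkhs_ip_ge0 : forall f, H f -> 0 <= ip f f;
  rkhs_ip_eq0 : forall f, H f -> ip f f = 0 -> f = (fun=> 0);
  rkhs_complete : forall u : nat -> E -> R, (forall k, H (u k)) ->
    (forall e : R, 0 < e -> exists N, forall k l, (N <= k)%N -> (N <= l)%N ->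
       rkhs_norm ip (u k \- u l) < e) ->
    exists2 f, H f & rkhs_norm ip (u k \- f) @[k --> \oo] --> (0 : R);
  rkhs_section : forall x, XX x -> H (K x);
  rkhs_reproducing : forall f x, H f -> XX x -> ip f (K x) = f x }.

(* The sequences are indexed from 0: mu i and phi i are the (i+1)-st eigenvalue
   and eigenfunction.  Eigenfunctions with mu i = 0 do not belong to H, so
   <phi_i, phi_j>_H = delta_ij / mu_i concerns the positive eigenvalues. *)
Record is_mercer_expansion (XX : set E) (PX : probability E R)
    (K : E -> E -> R) (H : set (E -> R)) (ip : (E -> R) -> (E -> R) -> R)
    (mu : nat -> R) (phi : nat -> E -> R) : Prop := {
  mercer_mu_ge0 : forall i, 0 <= mu i;
  mercer_mu_noninc : forall i j, (i <= j)%N -> mu j <= mu i;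
  mercer_sum : forall x x', XX x -> XX x' ->
    series (fun i => mu i * phi i x * phi i x') @ \oo --> K x x';
  mercer_meas : forall i, measurable_fun XX (phi i);
  mercer_integrable : forall i j,
    PX.-integrable XX (fun x => (phi i x * phi j x)%:E);
  mercer_L2 : forall i j,
    (\int[PX]_(x in XX) (phi i x * phi j x)%:E = (i == j)%:R%:E)%E;
  mercer_H : forall i, 0 < mu i -> H (phi i);
  mercer_ip : forall i j, 0 < mu i -> 0 < mu j ->
    ip (phi i) (phi j) = (i == j)%:R / mu i }.

Definition subset_L2 (XX : set E) (PX : probability E R) (H : set (E -> R)) :
    Prop :=
  forall f, H f ->
    measurable_fun XX f /\ PX.-integrable XX (fun x => (f x ^+ 2)%:E).

End Kernel_space.

Section Sampling.
Context {R : realType}.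

Definition noise_sd : R := 1.

(* The last clause is the mutual independence of all the X_i and all the eps_j;
   arbitrary finite subfamilies are covered by taking A i or B i to be the full
   space. *)
Definition random_design (d : nat) (dO : measure_display)
    (Omega : measurableType dO) (P : probability Omega R)
    (PX : probability (d.-tuple R) R)
    (X : nat -> {RV P >-> d.-tuple R}) (eps : nat -> {RV P >-> R}) : Prop :=
  [/\ forall i A, measurable A -> distribution P (X i) A = PX A,
      forall i B, measurable B ->
        distribution P (eps i) B = normal_prob 0 noise_sd B &
      forall (n : nat) (A : nat -> set (d.-tuple R)) (B : nat -> set R),
        (forall i, measurable (A i)) -> (forall i, measurable (B i)) ->
        P [set w | forall i, (i < n)%N -> A i (X i w) /\ B i (eps i w)] =
        (\prod_(i < n) (P (X i @^-1` A i) * P (eps i @^-1` B i)))%E].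

Definition normal_percentile (p : R) : R :=
  inf [set z : R | (p%:E <= normal_prob (0 : R) 1 `]-oo, z])%E].

End Sampling.

Section Gradient_descent.
Context {R : realType}.
Variable alpha : nat -> R.

Definition total_step (t : nat) : R := \sum_(tau < t) alpha tau.

(* kappa_t = min {j >= 1 : mu_j < 1 / eta_t} - 1, where mu_j is written
   mu (j - 1). *)
Definition kappa (mu : nat -> R) (t : nat) : nat :=
  xget 0%N (is_minimum [set j | mu j < (total_step t)^-1]).

Variable n : nat.

Definition emp_norm (v : 'cV[R]_n) : R :=
  Num.sqrt (n%:R^-1 * \sum_i v i 0 ^+ 2).

Fixpoint gd_fit (Kn : 'M[R]_n) (y : 'cV[R]_n) (t : nat) : 'cV[R]_n :=
  if t is s.+1 then
    gd_fit Kn y s - alpha s *: (Kn *m (gd_fit Kn y s - y))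
  else 0.

(* muhat is the row (muhat_1, ..., muhat_n) of empirical eigenvalues, indexed
   from 0. *)
Variable muhat : 'rV[R]_n.

Definition shrinkage (t : nat) : 'M[R]_n :=
  \prod_(tau < t) (1%:M - alpha tau *: diag_mx muhat).

Definition mean_H0 (t : nat) : R :=
  n%:R^-1 * \tr ((1%:M - shrinkage t) ^+ 2).

Definition sd_H0 (t : nat) : R :=
  Num.sqrt (2 / n%:R ^+ 2 * \tr ((1%:M - shrinkage t) ^+ 4)).

Definition wald_test (lev : R) (Kn : 'M[R]_n) (t : nat) (y : 'cV[R]_n) : bool :=
  normal_percentile (1 - lev / 2) * sd_H0 t
    <= `| emp_norm (gd_fit Kn y t) ^+ 2 - mean_H0 t |.

Definition sep_rate (t : nat) : R := Num.sqrt ((total_step t)^-1 + sd_H0 t).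

Definition complexity (t : nat) : R :=
  n%:R^-1 * Num.sqrt (\sum_i Num.min 1 (total_step t * muhat 0 i)).

Definition sep_rate_order (t : nat) : R :=
  Num.sqrt ((total_step t)^-1 + complexity t).

(* At t = 0 the total step size is 0, and the inequality below reads 0 < 0 in Rocq:
   0 never satisfies the rule, in agreement with 1 / eta_0 = +oo. *)
Definition stopping_rule : set nat :=
  [set t | (total_step t)^-1 < noise_sd * complexity t].

End Gradient_descent.

Section Empirical_kernel.
Context {R : realType} {d : nat}.
Local Notation E := (d.-tuple R).

Definition kernel_mx (K : E -> E -> R) (n : nat) (x : 'I_n -> E) : 'M[R]_n :=
  \matrix_(i, j) (n%:R^-1 * K (x i) (x j)).

Definition values (n : nat) (x : 'I_n -> E) (f : E -> R) : 'cV[R]_n :=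
  \col_i f (x i).

Definition spectral_decomposition (n : nat) (A U : 'M[R]_n) (lam : 'rV[R]_n) :
    Prop :=
  [/\ A = U *m diag_mx lam *m U^T, U *m U^T = 1%:M,
      forall i j : 'I_n, (i <= j)%N -> lam 0 j <= lam 0 i &
      forall i, 0 <= lam 0 i].

Context {dO : measure_display} {Omega : measurableType dO}.
Variables (P : probability Omega R).

Definition design (X : nat -> {RV P >-> E}) (n : nat) (w : Omega) : 'I_n -> E :=
  fun i => X i w.

(* P_f (phi_{n,t} = 1 | x): since the noise is independent of the covariates,
   the regular conditional law of y given x is the law of (f (x_i) + eps_i)_i
   with x held fixed. *)
Definition cond_power (eps : nat -> {RV P >-> R}) (alpha : nat -> R) (lev : R)
    (K : E -> E -> R) (n : nat) (x : 'I_n -> E) (muhat : 'rV[R]_n)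
    (f : E -> R) (t : nat) : \bar R :=
  P [set w | wald_test alpha muhat lev (kernel_mx K x) t
               (values x f + \col_i eps i w)].

End Empirical_kernel.

Arguments design {R d dO Omega P} X n w i.

Section Step_sizes.
Context {R : realType}.

(* eta_{t1} << eta_{t2} whenever 0 <= t1 << t2 as t2 -> oo. *)
Definition preserves_negligibility (alpha : nat -> R) : Prop :=
  forall t1 : nat -> nat,
    ((t1 t2)%:R / t2%:R : R) @[t2 --> \oo] --> (0 : R) ->
    (total_step alpha (t1 t2) / total_step alpha t2) @[t2 --> \oo] --> (0 : R).

(* alpha_tau <= 1 / muhat_1 is written alpha_tau * muhat_1 <= 1, which is no
   constraint when muhat_1 = 0. *)
Definition admissible_step (n : nat) (muhat : 'rV[R]_n) (a : R) : Prop :=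
  [/\ 0 <= a, a <= 1 &
      forall i : 'I_n, i = 0%N :> nat -> a * muhat 0 i <= 1].

End Step_sizes.

(* Main.v *)
Require Import Defs.
From HB Require Import structures.
From mathcomp Require Import all_boot all_order all_algebra.
From mathcomp Require Import all_classical all_reals all_analysis.
From mathcomp Require Import measurable_realfun simple_functions.
From mathcomp Require Import measurable_fun_approximation.
From mathcomp Require Import ring lra.

Set Implicit Arguments.
Unset Strict Implicit.
Unset Printing Implicit Defensive.

Import Order.TTheory GRing.Theory Num.Theory.
Import numFieldNormedType.Exports.

Local Open Scope classical_set_scope.
Local Open Scope ring_scope.

(** Power. Fix the covariates. In the eigenbasis of the empirical kernel
matrix, gradient descent multiplies the k-th coordinate of the data by q_k = 1
- s_k, where s_k is the product of the factors 1 - alpha_tau muhat_k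
([gd_fit_coordinates]). If g_k are the coordinates of (f(x_1), ..., f(x_n)),
the centred statistic is therefore
  D - mu = (X + Z) / n,   X = sum_k q_k^2 g_k^2,
where Z is a linear form plus a centred quadratic form in the noise
([quadratic_statistic_split], [wald_statistic]).

The signal X is controlled by the reproducing property: Cauchy-Schwarz in H
gives (sum_k b_k g_k)^2 <= ||f||_H^2 n sum_k muhat_k b_k^2 for all weights b
([coordinate_evaluation_bound]), and s_k (1 + eta muhat_k) <= 1, so the part
of the signal that gradient descent discards, sum_k s_k^2 g_k^2, is at most
C^2 n / eta. Separation of f then forces X to exceed a large multiple of n
sigma ([signal_energy_bound]). The same inequality shows that ||f||_n^2 <= C^2
/ eta as soon as all muhat_k are at most 1 / eta; separation excludes this, so
some q_k is at least 1/2 and n sigma is bounded below ([sd_H0_lower_bound]).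
Both bounds hold for every design whose steps are admissible, that is, almost
surely, and for all n and t at least 1.

For the noise, products of Hermite polynomials in independent standard normal
variables are orthogonal, whence E Z^2 <= const (X + n^2 sigma^2), and the
power bound is Chebyshev's inequality ([noise_form_tail], [wald_power]).
Independence is given as a product rule for events; it becomes a product rule
for expectations by passing from indicators to integrable functions one
coordinate at a time ([independent_prod_has_mean]). The moments of the normal
law come from the fact that an exponential tilt of a normal density is again a
multiple of one.

Stopping rule. As t grows, 1 / eta_t decreases and the complexity term
increases. From T on the complexity term dominates, before T the term 1 /
eta_t does. Since the steps are non-increasing, one step at most doubles eta
and hence the complexity, so that passing from T - 1 to T costs only a
constant factor ([sep_rate_order_minimal]). *)

(** * Integrals against a weight *)

Section weighted_integral.
Context d d' (T : measurableType d) (E : measurableType d') (R : realType).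
Variables (m : {measure set T -> \bar R}) (Phi : T -> R) (Y : T -> E).
Hypotheses (mPhi : measurable_fun setT Phi) (Phi0 : forall x, 0 <= Phi x).
Hypothesis mY : measurable_fun setT Y.

Import HBNNSimple.

(** Monotone convergence along the canonical simple approximations of g. The
right-hand side involves the measure and the weight only through the integrals
of indicators, which is what makes [weighted_integral_ext] immediate. *)
Lemma weighted_integral_approx (g : E -> R)
    (mg : measurable_fun [set: E] (EFin \o g)) : (forall y, 0 <= g y) ->
  (\int[m]_x (Phi x * g (Y x))%:E =
   limn (fun n => \sum_(y \in range (nnsfun_approx measurableT mg n))
     (y%:E * \int[m]_x (Phi x *
         \1_(nnsfun_approx measurableT mg n @^-1` [set y]) (Y x))%:E)))%E.
Proof.
move=> g0; set h := nnsfun_approx _ mg.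
have mh n : measurable_fun setT (fun x => h n (Y x)).
  by apply: measurableT_comp => //; exact: measurable_funP.
have mi n r : measurable_fun setT (fun x => \1_(h n @^-1` [set r]) (Y x) : R).
  apply: (measurableT_comp (f := \1_(h n @^-1` [set r]) : E -> R)) => //.
have -> : (\int[m]_x (Phi x * g (Y x))%:E =
    limn (fun n => \int[m]_x (Phi x * h n (Y x))%:E))%E.
  have fg x : setT x -> (Phi x * g (Y x))%:E =
      limn (fun n => (Phi x * h n (Y x))%:E).
    move=> _; apply/esym/cvg_lim => //.
    rewrite EFinM.
    rewrite (_ : (fun n => _) = (fun n => (Phi x)%:E * (h n (Y x))%:E)%E)//.
    apply: cvgeZl => //.
    by apply: (cvg_nnsfun_approx measurableT mg) => // z _; rewrite lee_fin.
  under eq_integral => x /[!inE] /fg -> //.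
  apply: monotone_convergence => //.
  - by move=> n; apply/measurable_EFinP; exact: measurable_funM.
  - by move=> n x _; rewrite lee_fin mulr_ge0.
  - move=> x _ a b ab; rewrite lee_fin ler_wpM2l//.
    exact/lefP/nd_nnsfun_approx.
apply: (congr1 (fun u : (\bar R)^nat => limn u)); apply/funext => n.
transitivity (\int[m]_x (\sum_(y \in range (h n))
    (y * (Phi x * \1_(h n @^-1` [set y]) (Y x)))%:E))%E.
  apply: eq_integral => x _; rewrite fimfunE fsumEFin//; congr EFin.
  by rewrite !fsbig_finite//= mulr_sumr; apply: eq_bigr => y _; rewrite mulrCA.
rewrite ge0_integral_fsum//; last 2 first.
- move=> y; apply/measurable_EFinP; apply: measurable_funM => //.
  exact: measurable_funM.
- move=> y x _; have := @nnfun_muleindic_ge0 _ _ _ (h n) y (Y x).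
  by rewrite !lee_fin mulrCA => ?; rewrite mulr_ge0.
apply: eq_fsbigr => y; rewrite inE => -[z _ <-].
under eq_integral do rewrite EFinM.
rewrite ge0_integralZl//.
- by apply/measurable_EFinP; exact: measurable_funM.
- by move=> x _; rewrite lee_fin mulr_ge0.
- by rewrite lee_fin.
Qed.

End weighted_integral.

Section weighted_ext.
Import HBNNSimple.

(** Two weighted laws that agree on measurable sets agree on non-negative
functions. With the two sides living on different spaces, this covers at once
densities, image laws and the effect of an independent factor. *)
Lemma weighted_integral_ext d d1 d2 (E : measurableType d)
    (T1 : measurableType d1) (T2 : measurableType d2) (R : realType)
    (m1 : {measure set T1 -> \bar R}) (m2 : {measure set T2 -> \bar R})
    (Phi1 : T1 -> R) (Phi2 : T2 -> R) (Y1 : T1 -> E) (Y2 : T2 -> E) :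
  measurable_fun setT Phi1 -> measurable_fun setT Phi2 ->
  (forall x, 0 <= Phi1 x) -> (forall x, 0 <= Phi2 x) ->
  measurable_fun setT Y1 -> measurable_fun setT Y2 ->
  (forall A, measurable A -> (\int[m1]_x (Phi1 x * \1_A (Y1 x))%:E =
     \int[m2]_x (Phi2 x * \1_A (Y2 x))%:E)%E) ->
  forall g : E -> R, measurable_fun setT g -> (forall y, 0 <= g y) ->
  (\int[m1]_x (Phi1 x * g (Y1 x))%:E = \int[m2]_x (Phi2 x * g (Y2 x))%:E)%E.
Proof.
move=> mP1 mP2 P1 P2 mY1 mY2 H g mg g0.
have mg' : measurable_fun [set: E] (EFin \o g) by exact/measurable_EFinP.
rewrite (weighted_integral_approx m1 mP1 P1 mY1 mg' g0).
rewrite (weighted_integral_approx m2 mP2 P2 mY2 mg' g0).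
apply: (congr1 (fun u : (\bar R)^nat => limn u)); apply/funext => n.
apply: eq_fsbigr => y _; congr (_ * _)%E; apply: H.
rewrite -[X in measurable X]setTI.
exact: (@measurable_funP _ _ _ _ setT (nnsfun_approx measurableT mg' n)).
Qed.

End weighted_ext.

(** * Exponential tilts of the standard normal law *)

Lemma ge0_integral_normal_prob (R : realType) (m s : R) (g : R -> R) :
  measurable_fun setT g -> (forall x, 0 <= g x) ->
  (\int[normal_prob m s]_x (g x)%:E =
   \int[lebesgue_measure]_x (normal_pdf m s x * g x)%:E)%E.
Proof.
move=> mg g0.
have -> : (\int[normal_prob m s]_x (g x)%:E =
    \int[normal_prob m s]_x (cst 1 x * g (idfun x))%:E)%E.
  by apply: eq_integral => x _; rewrite mul1r.
have mp := @measurable_normal_pdf R m s.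
rewrite (@weighted_integral_ext _ _ _ _ _ _ R (@normal_prob R m s)
  (@lebesgue_measure R) (cst 1) (normal_pdf m s) idfun idfun)//.
- by move=> x; exact: normal_pdf_ge0.
- exact: measurable_id.
- exact: measurable_id.
- move=> A mA.
  under eq_integral do rewrite /= mul1r.
  rewrite integral_indic// setIT /normal_prob /= [LHS]integral_mkcond.
  apply: eq_integral => x _.
  by rewrite patchE indicE; case: (x \in A); rewrite ?mulr1 ?mulr0.
Qed.

(** A normal density has mass 1 whatever its parameters, so no integral has to
be computed: the moment of [w] can be read off the constant of proportionality.
*)
Lemma integral_normal_tilt (R : realType) (w : R -> R) (c m s : R) :
  measurable_fun setT w -> (forall x, 0 <= w x) -> 0 <= c ->
  (forall x, normal_pdf 0 1 x * w x = c * normal_pdf m s x) ->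
  (\int[normal_prob 0 1]_x (w x)%:E = c%:E)%E.
Proof.
move=> mw w0 c0 wE; rewrite ge0_integral_normal_prob//.
under eq_integral do rewrite wE EFinM.
rewrite ge0_integralZl//.
- by rewrite integral_normal_pdf mule1.
- by apply/measurable_EFinP; exact: measurable_normal_pdf.
- by move=> x _; rewrite lee_fin normal_pdf_ge0.
Qed.

(** Completing the square in t x - x^2 / 2 gives the normal density centred at
t. *)
Lemma integral_normal_expR (R : realType) (t : R) :
  (\int[normal_prob 0 1]_x (expR (t * x))%:E = (expR (t ^+ 2 / 2))%:E)%E.
Proof.
apply: (@integral_normal_tilt _ _ _ t 1); rewrite ?expR_ge0//.
  by apply: measurableT_comp => //; exact: measurable_funM.
move=> x; rewrite !normal_pdfE ?oner_eq0//= /normal_fun mulrCA -!mulrA.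
rewrite -!expRD; congr (_ * expR _).
by rewrite subr0; field.
Qed.

(** The tilt by exp (h x^2) turns the variance 1 into 1 / (1 - 2 h). *)
Lemma integral_normal_expR_sqr (R : realType) (h : R) : h < 2^-1 ->
  (\int[normal_prob 0 1]_x (expR (h * x ^+ 2))%:E =
   (Num.sqrt (1 - 2 * h))^-1%:E)%E.
Proof.
move=> h12; set r := Num.sqrt (1 - 2 * h).
have r0 : 0 < r by rewrite sqrtr_gt0; lra.
have r2 : r ^+ 2 = 1 - 2 * h by rewrite sqr_sqrtr//; lra.
apply: (@integral_normal_tilt _ _ _ 0 r^-1).
- apply: measurableT_comp => //; apply: measurable_funM => //.
- by move=> x; exact: expR_ge0.
- by rewrite invr_ge0 ltW.
have rN0 : r != 0 by rewrite gt_eqF.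
move=> x; rewrite !normal_pdfE ?oner_eq0 ?invr_eq0//= /normal_fun.
rewrite [RHS]mulrA -[LHS]mulrA -expRD; congr (_ * expR _).
  rewrite /normal_peak exprVn -!mulrnAr sqrtrM ?expr1n//.
  rewrite sqrtrM ?invr_ge0 ?sqr_ge0// sqrtr1 mul1r sqrtrV ?sqr_ge0//.
  by rewrite sqrtr_sqr gtr0_norm// invfM invrK mulKf.
rewrite !subr0 exprVn r2; field; lra.
Qed.

(** * Integrable functions and their means *)

Section has_mean.
Context d (T : measurableType d) (R : realType).
Variable m : {measure set T -> \bar R}.
Implicit Types (f g : T -> R) (a b c : R).

(** Integrability and the value of the integral are kept together, so that
finite sums and products can be integrated without separate integrability
proofs. *)
Definition has_mean f a : Prop :=
  m.-integrable setT (EFin \o f) /\ (\int[m]_x (f x)%:E = a%:E)%E.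

Lemma has_mean_measurable f a : has_mean f a -> measurable_fun setT f.
Proof. by move=> [/integrableP[/measurable_EFinP]]. Qed.

Lemma ge0_has_mean f a : measurable_fun setT f -> (forall x, 0 <= f x) ->
  (\int[m]_x (f x)%:E = a%:E)%E -> has_mean f a.
Proof.
move=> mf f0 fa; split => //; apply/integrableP; split.
  exact/measurable_EFinP.
under eq_integral do rewrite /= ger0_norm//.
by rewrite fa ltry.
Qed.

Lemma eq_has_mean f g a : f =1 g -> has_mean f a -> has_mean g a.
Proof. by move=> /funext ->. Qed.

Lemma has_meanD f g a b :
  has_mean f a -> has_mean g b -> has_mean (fun x => f x + g x) (a + b).
Proof.
move=> [fi fa] [gi gb]; split; first exact: (integrableD measurableT fi gi).
under eq_integral do rewrite EFinD.
by rewrite (integralD measurableT fi gi) EFinD -fa -gb.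
Qed.

Lemma has_meanZ c f a : has_mean f a -> has_mean (fun x => c * f x) (c * a).
Proof.
move=> [fi fa]; split; first exact: (integrableZl measurableT c fi).
under eq_integral do rewrite EFinM.
by rewrite (integralZl measurableT fi) EFinM -fa.
Qed.

Lemma has_meanB f g a b :
  has_mean f a -> has_mean g b -> has_mean (fun x => f x - g x) (a - b).
Proof.
move=> fa /(has_meanZ (-1)) gb; rewrite -[- b]mulN1r.
by apply: eq_has_mean (has_meanD fa gb) => x; rewrite mulN1r.
Qed.

Lemma has_mean_sum (I : Type) (s : seq I) (Q : pred I) (f : I -> T -> R)
    (a : I -> R) : (forall i, has_mean (f i) (a i)) ->
  has_mean (fun x => \sum_(i <- s | Q i) f i x) (\sum_(i <- s | Q i) a i).
Proof.
move=> fa; elim: s => [|i s IH].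
  rewrite big_nil; apply: (@eq_has_mean (fun=> 0)).
    by move=> x; rewrite big_nil.
  by apply: ge0_has_mean => //; rewrite integral0.
rewrite big_cons; case: ifPn => Qi.
  apply: eq_has_mean (has_meanD (fa i) IH) => x.
  by rewrite big_cons Qi.
by apply: eq_has_mean IH => x; rewrite big_cons (negbTE Qi).
Qed.

Lemma le_has_mean f g a b : (forall x, f x <= g x) ->
  has_mean f a -> has_mean g b -> a <= b.
Proof.
move=> fg [fi fa] [gi gb]; rewrite -lee_fin -fa -gb.
by apply: le_integral => // x _; rewrite lee_fin.
Qed.

Lemma dominated_has_mean f g b : measurable_fun setT f ->
  (forall x, `|f x| <= g x) -> has_mean g b -> exists a, has_mean f a.
Proof.
move=> mf fg [gi gb].
have fi : m.-integrable setT (EFin \o f).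
  apply: (le_integrable measurableT _ _ gi); first exact/measurable_EFinP.
  by move=> x _; rewrite /= lee_fin (le_trans (fg x)) ?ler_norm.
exists (fine (\int[m]_x (f x)%:E)); split => //.
by rewrite fineK//; exact: integrable_fin_num.
Qed.

Lemma has_mean_unique f a b : has_mean f a -> has_mean f b -> a = b.
Proof. by move=> [_ fa] [_]; rewrite fa => -[]. Qed.

Lemma has_mean_norm f a : has_mean f a -> exists b, has_mean (Num.norm \o f) b.
Proof.
move=> fa; have mf := has_mean_measurable fa.
have fi : m.-integrable setT (EFin \o (Num.norm \o f)).
  exact: integrable_norm fa.1.
exists (fine (\int[m]_x (`|f x|)%:E)); split => //.
by rewrite fineK//; exact: integrable_fin_num.
Qed.

Lemma markov_has_mean f a c : 0 < c -> (forall x, 0 <= f x) ->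
  has_mean f a -> (m [set x | (c <= f x)%R] <= (a / c)%:E)%E.
Proof.
move=> c0 f0 fa; have mf := has_mean_measurable fa.
have mA : measurable [set x | c <= f x].
  by rewrite -[X in measurable X]setTI; exact: measurable_fun_le.
rewrite -[X in m X]setIT -integral_indic//.
suff : (c%:E * \int[m]_x (\1_[set x | (c <= f x)%R] x)%:E <= a%:E)%E.
  by rewrite muleC -lee_pdivlMr.
rewrite -ge0_integralZl//; last 2 first.
- by apply/measurable_EFinP; exact: measurable_indic.
- by rewrite lee_fin ltW.
case: fa => _ <-; apply: ge0_le_integral => //.
- by move=> x _; rewrite mule_ge0// lee_fin// ltW.
- by apply/measurable_EFinP; apply: measurable_funM.
- exact/measurable_EFinP.
- move=> x _; rewrite -EFinM lee_fin indicE.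
  case: (boolP (x \in _)) => [/set_mem/= cf|_].
    by rewrite mulr1.
  by rewrite mulr0.
Qed.

End has_mean.

Lemma has_mean_cst d (T : measurableType d) (R : realType)
  (P : probability T R) (c : R) : has_mean P (fun=> c) c.
Proof.
split; first exact: finite_measure_integrable_cst.
rewrite -[RHS]mule1 -(probability_setT P).
exact: (integral_cst P measurableT c%:E).
Qed.

(** * Moments of the standard normal law *)

(** A function with a maximum at an interior point has derivative zero there:
the form in which first-order information is extracted below from one-parameter
families of inequalities. *)
Lemma eq0_of_le_sqr (R : realFieldType) (a k delta : R) : 0 < delta ->
  (forall t, `|t| <= delta -> t * a <= k * t ^+ 2) -> a = 0.
Proof.
move=> d0 H; apply/eqP/negPn/negP => a0.
have na : 0 < `|a| by rewrite normr_gt0.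
pose s := Num.min (delta / `|a|) (1 + `|k|)^-1.
have k1 : 0 < 1 + `|k| by rewrite ltr_pwDl.
have s0 : 0 < s by rewrite lt_min divr_gt0//= invr_gt0.
have ks : k * s < 1.
  apply: (@le_lt_trans _ _ (`|k| / (1 + `|k|))); last first.
    by rewrite ltr_pdivrMr// mul1r ltrDr.
  apply: (@le_trans _ _ (`|k| * s)); first by rewrite ler_wpM2r ?ler_norm// ltW.
  by rewrite ler_wpM2l// ge_min lexx orbT.
have sd : `|s * a| <= delta.
  by rewrite normrM gtr0_norm// -ler_pdivlMr// ge_min lexx.
have a2 : 0 < s * a ^+ 2 by rewrite mulr_gt0// exprn_even_gt0.
have := H _ sd; rewrite leNgt => /negP; apply.
rewrite (_ : k * _ = k * s * (s * a ^+ 2)); last by ring.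
by rewrite (_ : s * a * a = s * a ^+ 2) ?gtr_pMl//; ring.
Qed.

Section normal_moments.
Context {R : realType}.
Local Notation N := (@normal_prob R 0 1).

Lemma normal_has_mean_expR (t : R) :
  has_mean N (fun x => expR (t * x)) (expR (t ^+ 2 / 2)).
Proof.
apply: ge0_has_mean; last exact: integral_normal_expR.
  by apply: measurableT_comp => //; exact: measurable_funM.
by move=> x; exact: expR_ge0.
Qed.

Lemma normal_has_mean_expR_sqr (h : R) : h < 2^-1 ->
  has_mean N (fun x => expR (h * x ^+ 2)) (Num.sqrt (1 - 2 * h))^-1.
Proof.
move=> h2; apply: ge0_has_mean; last exact: integral_normal_expR_sqr.
  by apply: measurableT_comp => //; exact: measurable_funM.
by move=> x; exact: expR_ge0.
Qed.

Lemma normal_has_mean_bounded (f : R -> R) (c : R) : measurable_fun setT f ->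
  (forall x, `|f x| <= c * (1 + x ^+ 4)) -> exists a, has_mean N f a.
Proof.
move=> mf fb; have h4 : (4^-1 : R) < 2^-1 by lra.
have c0 : 0 <= c.
  by have := fb 0; rewrite expr0n addr0 mulr1; exact: le_trans.
(* [normal_prob] lives on [measurableTypeR R], which is R with a measurable
   structure convertible to, but not unifiable with, the canonical one *)
have mf' : @measurable_fun _ _ (measurableTypeR R) (measurableTypeR R) setT f.
  exact: mf.
have domin := has_meanZ (c * 33) (normal_has_mean_expR_sqr h4).
(* 1 + x^4 <= 33 exp(x^2 / 4) because exp u >= 1 + u^2 / 2 *)
apply: (dominated_has_mean mf' _ domin) => x.
apply: le_trans (fb x) _; rewrite -mulrA ler_wpM2l//.
have := @expR_ge1Dxn R (4^-1 * x ^+ 2) 1; rewrite mulr_ge0 ?sqr_ge0 ?invr_ge0//.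
move=> /(_ isT); rewrite (_ : (2`!)%N = 2%N)//.
have := @expR_ge1Dx R (4^-1 * x ^+ 2).
by have := sqr_ge0 x => *; lra.
Qed.

(** Integrating 1 + t x <= exp (t x) yields 1 + t a <= exp (t^2 / 2) for the
mean a and all t of both signs, and the right-hand side is 1 + O(t^2). *)
Lemma normal_mean0 : has_mean N id 0.
Proof.
have [|a ha] := @normal_has_mean_bounded id 1 (@measurable_id _ _ setT).
  move=> x /=; rewrite mul1r ler_norml.
  have := sqr_ge0 (x ^+ 2 - 1); have := sqr_ge0 (x - 1).
  have := sqr_ge0 (x + 1); have := sqr_ge0 (x ^+ 2) => *.
  by apply/andP; split; lra.
suff a0 : a = 0 by rewrite a0 in ha.
have le1 t : 1 + t * a <= expR (t ^+ 2 / 2).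
  have h1 := has_meanD (has_mean_cst N 1) (has_meanZ t ha).
  by apply: (le_has_mean _ h1 (normal_has_mean_expR t)) => x; exact: expR_ge1Dx.
apply: (@eq0_of_le_sqr R a 1 1) => // t t1.
have t2 : t ^+ 2 <= 1 by rewrite -real_normK ?num_real// expr_le1.
rewrite mul1r leNgt; apply/negP => tat.
have t0 := sqr_ge0 t.
have : (1 + t ^+ 2) * (1 - t ^+ 2 / 2) < 1.
  apply: (@lt_le_trans _ _ ((1 + t * a) * (1 - t ^+ 2 / 2))).
    by rewrite ltr_pM2r ?ltrD2l//; lra.
  rewrite -[leRHS](expRxMexpNx_1 (t ^+ 2 / 2)).
  apply: ler_pM; [lra|lra|exact: le1|].
  exact: expR_ge1Dx.
have : t ^+ 2 * t ^+ 2 <= t ^+ 2 by rewrite ler_piMr.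
by move=> *; lra.
Qed.

(** As for the mean: integrating 1 + h x^2 <= exp (h x^2) yields 1 + h a <= (1 -
2 h)^(-1/2), whose right-hand side has derivative 1 at h = 0. *)
Lemma normal_moment2 : has_mean N (fun x => x ^+ 2) 1.
Proof.
have [|a ha] :=
  @normal_has_mean_bounded (fun x => x ^+ 2) 1 (@exprn_measurable _ setT 2).
  move=> x /=; rewrite mul1r ger0_norm ?sqr_ge0//.
  by have := sqr_ge0 (x ^+ 2 - 1); have := sqr_ge0 (x ^+ 2) => *; lra.
suff /eqP : a - 1 = 0 by rewrite subr_eq0 => /eqP a1; rewrite a1 in ha.
have a_ge0 : 0 <= a.
  apply: (le_has_mean _ (has_mean_cst N 0) ha) => x; exact: sqr_ge0.
have le1 h : h < 2^-1 -> 1 + h * a <= (Num.sqrt (1 - 2 * h))^-1.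
  move=> h2; have h1 := has_meanD (has_mean_cst N 1) (has_meanZ h ha).
  apply: (le_has_mean _ h1 (normal_has_mean_expR_sqr h2)) => x.
  exact: expR_ge1Dx.
have d0 : 0 < (4 * (1 + a))^-1 by rewrite invr_gt0; lra.
apply: (@eq0_of_le_sqr R _ (2 * a) _ d0) => h hd.
have hda : `|h| * (4 * (1 + a)) <= 1 by rewrite -ler_pdivlMr ?div1r//; lra.
have ha_ge0 : 0 <= `|h| * a by rewrite mulr_ge0.
have hh := normr_ge0 h.
have h2 : h < 2^-1 by have := ler_norm h; lra.
have hN : - `|h| <= h by rewrite lerNl -normrN ler_norm.
have p0 : 0 <= 1 + h * a by have := ler_wpM2r a_ge0 hN; lra.
have r0 : 0 < Num.sqrt (1 - 2 * h) by rewrite sqrtr_gt0; lra.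
have r2 : Num.sqrt (1 - 2 * h) ^+ 2 = 1 - 2 * h by rewrite sqr_sqrtr//; lra.
have := le1 h h2; rewrite -[_^-1]mul1r ler_pdivlMr// => H.
have : ((1 + h * a) * Num.sqrt (1 - 2 * h)) ^+ 2 <= 1.
  by rewrite expr_le1// mulr_ge0// ltW.
rewrite exprMn r2.
have : 0 <= (h * a) ^+ 2 * (1 - 2 * h) by rewrite mulr_ge0 ?sqr_ge0//; lra.
by move=> *; lra.
Qed.

End normal_moments.

(** * Expectation of a product of independent variables *)

Section independent_product.
Context d (T : measurableType d) (R : realType) (P : probability T R).
Variable Y : nat -> T -> R.
Hypothesis mY : forall i, measurable_fun setT (Y i).
Hypothesis indepY : forall n (B : nat -> set R),
  (forall i, measurable (B i)) ->
  (P [set w | forall i, (i < n)%N -> B i (Y i w)] =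
   \prod_(i < n) P (Y i @^-1` B i))%E.
Variable n : nat.

Let prod_measurable (Q : pred 'I_n) (g : nat -> R -> R) :
  (forall i, measurable_fun setT (g i)) ->
  measurable_fun setT (fun w => \prod_(i < n | Q i) g i (Y i w)).
Proof.
move=> mg; under eq_fun do rewrite -big_filter.
by apply: measurable_prod => i _; exact: measurableT_comp.
Qed.

Let indic_prod (g : nat -> R -> R) (a : nat -> R) :
  (forall i, (i < n)%N -> exists2 B, measurable B & g i = \1_B) ->
  (forall i, (i < n)%N -> has_mean P (g i \o Y i) (a i)) ->
  has_mean P (fun w => \prod_(i < n) g i (Y i w)) (\prod_(i < n) a i).
Proof.
move=> gB ga.
have /choice[B hB] : forall i, exists B,
    measurable B /\ ((i < n)%N -> g i = \1_B).
  move=> i; case: (ltnP i n) => [/gB[B mB gE]|_]; first by exists B.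
  by exists setT; split.
have mB i : measurable (B i) by case: (hB i).
have gE i w : (i < n)%N -> g i (Y i w) = \1_(B i) (Y i w).
  by case: (hB i) => _ /[apply] ->.
pose S := [set w | forall i, (i < n)%N -> B i (Y i w)].
have mYB i : measurable (Y i @^-1` B i).
  by rewrite -[X in measurable X]setTI; exact: mY.
have mS : measurable S.
  rewrite (_ : S = \bigcap_(i in [set i | (i < n)%N]) (Y i @^-1` B i)).
    by apply: bigcap_measurableType => i _; exact: mYB.
  by apply/seteqP; split => w /= Sw i /Sw.
have SE w : \prod_(i < n) g i (Y i w) = \1_S w.
  rewrite indicE; have [Sw|Sw] := boolP (w \in S).
    rewrite big1// => i _; rewrite gE// indicE mem_set//.
    by move/set_mem : Sw; exact.
  have : ~ S w by move=> Sw'; rewrite mem_set in Sw.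
  move=> /existsNP[i /not_implyP[lin NB]].
  by rewrite (bigD1 (Ordinal lin))//= gE// indicE memNset// mul0r.
apply: (@eq_has_mean _ _ _ _ (\1_S)) => [w|]; first by rewrite SE.
apply: ge0_has_mean => //.
rewrite integral_indic// setIT -prodEFin; apply: etrans (indepY n mB) _.
apply: eq_bigr => i _.
case: (ga i (ltn_ord i)) => _ <-; apply: esym.
rewrite -[X in P X]setIT -integral_indic//.
by apply: eq_integral => w _; rewrite /= gE//.
Qed.

Let ge0_prod (k : nat) (g : nat -> R -> R) (a : nat -> R) :
  (forall i, measurable_fun setT (g i)) ->
  (forall i x, (i < n)%N -> 0 <= g i x) ->
  (forall i, (k <= i < n)%N -> exists2 B, measurable B & g i = \1_B) ->
  (forall i, (i < n)%N -> has_mean P (g i \o Y i) (a i)) ->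
  has_mean P (fun w => \prod_(i < n) g i (Y i w)) (\prod_(i < n) a i).
Proof.
elim: k g a => [|k IH] g a mg g0 gB ga.
  by apply: indic_prod => // i lin; exact: gB.
have [lkn|lnk] := ltnP k n; last first.
  apply: IH => // i /andP[ki lin]; apply: gB.
  by have := leq_trans lin lnk; rewrite ltnNge ki.
pose k0 := Ordinal lkn.
pose Phi w := \prod_(i < n | i != k0) g i (Y i w).
pose c := \prod_(i < n | i != k0) a i.
have splitE (h : nat -> R -> R) w : \prod_(i < n) h i (Y i w) =
    (\prod_(i < n | i != k0) h i (Y i w)) * h k (Y k w).
  by rewrite (bigD1 k0)//= mulrC.
(* an indicator at coordinate k falls under the induction hypothesis *)
have IHA A : measurable A ->
    has_mean P (fun w => Phi w * \1_A (Y k w)) (c * fine (P (Y k @^-1` A))).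
  move=> mA; pose h i := if i == k then \1_A else g i.
  pose b i := if i == k then fine (P (Y k @^-1` A)) else a i.
  have hNk (i : 'I_n) : i != k0 -> (i == k :> nat) = false.
    by move=> ik; apply/negbTE; apply: contra ik => /eqP ik; exact/eqP/val_inj.
  have -> : c * fine (P (Y k @^-1` A)) = \prod_(i < n) b i.
    rewrite (bigD1 k0)//= mulrC /b eqxx; congr (_ * _).
    by apply: eq_bigr => i /hNk ->.
  have mYA : measurable (Y k @^-1` A).
    by rewrite -[X in measurable X]setTI; exact: mY.
  apply: eq_has_mean (IH h b _ _ _ _) => [w|i|i x|i|i].
  - rewrite splitE /h eqxx; congr (_ * _).
    by apply: eq_bigr => i /hNk ->.
  - by rewrite /h; case: eqP => // _; exact: measurable_indic.
  - by rewrite /h; case: eqP => // _; exact: g0.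
  - move=> /andP[ki lin]; rewrite /h; case: eqVneq => ik; first by exists A.
    by apply: gB; rewrite lin andbT ltn_neqAle eq_sym ik.
  - move=> lin; rewrite /h /b; case: eqP => [->|_]; last exact: ga.
    apply: ge0_has_mean => //.
      by apply: measurableT_comp => //; exact: measurable_indic.
    rewrite (_ : (fun x => _) = (fun x => (\1_(Y k @^-1` A) x)%:E))//.
    by rewrite integral_indic// setIT fineK// fin_num_measure.
have mPhi : measurable_fun setT Phi by exact: prod_measurable.
have Phi0 w : 0 <= Phi w by apply: prodr_ge0 => i _; exact: g0.
have c0 : 0 <= c.
  apply: prodr_ge0 => i _.
  apply: (le_has_mean _ (has_mean_cst P 0)) (ga i _) => //.
  by move=> w; exact: g0.
apply: ge0_has_mean.
- exact: prod_measurable.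
- by move=> w; apply: prodr_ge0 => i _; exact: g0.
under eq_integral do rewrite splitE.
rewrite (@weighted_integral_ext _ _ _ _ _ _ R P P Phi (cst c) (Y k) (Y k))//;
  last by move=> y; exact: g0.
- have [gi gk] := has_meanZ c (ga k lkn).
  by rewrite [LHS]gk (bigD1 k0)//= mulrC.
- move=> A mA; have [_ ->] := IHA A mA.
  have mYA : measurable (Y k @^-1` A).
    by rewrite -[X in measurable X]setTI; exact: mY.
  under eq_integral do rewrite /= EFinM.
  rewrite ge0_integralZl//.
  + rewrite (_ : (fun x => _) = (fun x => (\1_(Y k @^-1` A) x)%:E))//.
    by rewrite integral_indic// setIT EFinM fineK// fin_num_measure.
  + by apply/measurable_EFinP; apply: measurableT_comp.
Qed.

(** The product rule holds for indicators by independence. It extends to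
non-negative functions one coordinate at a time, the product of the other
factors serving as the weight in [weighted_integral_ext], and then to signed
functions, again one coordinate at a time, by splitting a factor into its
positive and negative parts. *)
Lemma independent_prod_has_mean (g : nat -> R -> R) (a : nat -> R) :
  (forall i, measurable_fun setT (g i)) ->
  (forall i, (i < n)%N -> has_mean P (g i \o Y i) (a i)) ->
  has_mean P (fun w => \prod_(i < n) g i (Y i w)) (\prod_(i < n) a i).
Proof.
suff signed k : forall (g : nat -> R -> R) (a : nat -> R),
    (forall i, measurable_fun setT (g i)) ->
    (forall i x, (k <= i < n)%N -> 0 <= g i x) ->
    (forall i, (i < n)%N -> has_mean P (g i \o Y i) (a i)) ->
    has_mean P (fun w => \prod_(i < n) g i (Y i w)) (\prod_(i < n) a i).
  move=> mg ga; apply: (signed n) => // i x.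
  by move=> /andP[ni /(leq_ltn_trans ni)]; rewrite ltnn.
elim: k => [|k IH] {}g {}a mg g0 ga.
  apply: (ge0_prod (k := n)) => // i.
  by move=> /andP[ni /(leq_ltn_trans ni)]; rewrite ltnn.
have [lkn|lnk] := ltnP k n; last first.
  apply: IH => // i x /andP[ki lin]; apply: g0.
  by have := leq_trans lin lnk; rewrite ltnNge ki.
pose k0 := Ordinal lkn.
have hNk (i : 'I_n) : i != k0 -> (i == k :> nat) = false.
  by move=> ik; apply/negbTE; apply: contra ik => /eqP ik; exact/eqP/val_inj.
have [b gb] := has_mean_norm (ga k lkn).
have part (f : R -> R) : measurable_fun setT f -> (forall x, 0 <= f x) ->
    (forall x, f x <= `|g k x|) -> exists2 c, has_mean P (f \o Y k) c &
    has_mean P (fun w => f (Y k w) * \prod_(i < n | i != k0) g i (Y i w))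
      (c * \prod_(i < n | i != k0) a i).
  move=> mf f0 fg.
  have [||c fc] := @dominated_has_mean _ _ _ P (f \o Y k) _ _ _ _ gb.
  - exact: measurableT_comp.
  - by move=> w; rewrite /= ger0_norm.
  exists c => //.
  pose h i := if i == k then f else g i.
  pose e i := if i == k then c else a i.
  have <- : \prod_(i < n) e i = c * \prod_(i < n | i != k0) a i.
    rewrite (bigD1 k0)//= /e eqxx; congr (_ * _).
    by apply: eq_bigr => i /hNk ->.
  apply: eq_has_mean (IH h e _ _ _) => [w|i|i x /andP[ki lin]|i lin].
  - rewrite (bigD1 k0)//= /h eqxx; congr (_ * _).
    by apply: eq_bigr => i /hNk ->.
  - by rewrite /h; case: eqP.
  - rewrite /h; case: eqVneq => // ik; apply: g0.
    by rewrite lin andbT ltn_neqAle eq_sym ik.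
  - by rewrite /h /e; case: eqP => [->|_]; last exact: ga.
have [|||p gp hp] := part (fun x => Num.max (g k x) 0).
- exact: measurable_maxr.
- by move=> x; rewrite le_max lexx orbT.
- by move=> x; rewrite ge_max ler_norm normr_ge0.
have [|||q gq hq] := part (fun x => Num.max (- g k x) 0).
- by apply: measurable_maxr => //; exact: measurableT_comp.
- by move=> x; rewrite le_max lexx orbT.
- by move=> x; rewrite ge_max -normrN ler_norm normr_ge0.
have gE x : g k x = Num.max (g k x) 0 - Num.max (- g k x) 0.
  by rewrite /Num.max; case: ifPn; case: ifPn => *; lra.
have aE : a k = p - q.
  apply: (has_mean_unique (ga k lkn)).
  by apply: eq_has_mean (has_meanB gp gq) => w; rewrite /= [RHS]gE.
rewrite (bigD1 k0)//= aE mulrBl.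
apply: eq_has_mean (has_meanB hp hq) => w.
by rewrite [RHS](bigD1 k0)//= {3}(gE (Y k w)) mulrBl.
Qed.

End independent_product.

(** * Hermite polynomials under the normal law *)

(** Transfer of means between a random variable and its law. The law is only
known through its values on measurable sets, hence the appeal to
[weighted_integral_ext] for the positive and negative parts. *)
Lemma has_mean_distribution d (T : measurableType d) (R : realType)
    (P : probability T R) (Y : {RV P >-> R}) (m s : R) (g : R -> R) (a : R) :
  (forall B, measurable B -> distribution P Y B = normal_prob m s B) ->
  measurable_fun setT g -> has_mean (@normal_prob R m s) g a ->
  has_mean P (g \o Y) a.
Proof.
move=> lawY mg [gi ga].
have mY : measurable_fun setT Y by exact: measurable_funP.
have transfer (f : R -> R) : measurable_fun setT f -> (forall x, 0 <= f x) ->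
    (\int[P]_x (f (Y x))%:E = \int[normal_prob m s]_x (f x)%:E)%E.
  move=> mf f0.
  have := @weighted_integral_ext _ _ _ _ _ _ R P (@normal_prob R m s)
    (cst 1) (cst 1) Y idfun.
  have e1 : (fun x => (cst 1 x * f (Y x))%:E) = (fun x => (f (Y x))%:E).
    by apply/funext => x; rewrite mul1r.
  have e2 : (fun x => (cst 1 x * f (idfun x))%:E) = (fun x => (f x)%:E).
    by apply/funext => x; rewrite mul1r.
  move=> /(_ _ _ _ _ mY _ _ f mf f0); rewrite e1 e2; apply => //.
  - exact: measurable_id.
  - move=> A mA; under eq_integral do rewrite mul1r.
    under [RHS]eq_integral do rewrite mul1r.
    rewrite [RHS]integral_indic// setIT; apply: etrans (lawY _ mA).
    rewrite /distribution /pushforward.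
    have mYA : measurable (Y @^-1` A).
      by rewrite -[X in measurable X]setTI; exact: mY.
    rewrite (_ : (fun x => _) = (fun x => (\1_(Y @^-1` A) x)%:E))//.
    by rewrite integral_indic// setIT.
have gYi : P.-integrable setT (EFin \o (g \o Y)).
  apply/integrableP; split.
    by apply/measurable_EFinP; exact: measurableT_comp.
  have /integrableP[_] := gi; congr (_ < _)%E; apply/esym.
  apply: (transfer (fun x => `|g x|)) => //.
  exact: measurableT_comp.
split => //; rewrite -ga.
rewrite integralE [RHS]integralE.
have posE (U : Type) (f : U -> R) :
    (fun x => (f x)%:E)^\+%E = (fun x => (Num.max (f x) 0)%:E).
  by apply/funext => x; rewrite funeposE EFin_max.
have negE (U : Type) (f : U -> R) :
    (fun x => (f x)%:E)^\-%E = (fun x => (Num.max (- f x) 0)%:E).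
  by apply/funext => x; rewrite funenegE EFin_max.
rewrite !posE !negE; congr (_ - _)%E.
- apply: (transfer (fun x => Num.max (g x) 0)) => [|x].
    exact: measurable_maxr.
  by rewrite le_max lexx orbT.
- apply: (transfer (fun x => Num.max (- g x) 0)) => [|x].
    by apply: measurable_maxr => //; exact: measurableT_comp.
  by rewrite le_max lexx orbT.
Qed.

Definition hermite {R : realType} (p : nat) (x : R) : R :=
  match p with 0 => 1 | 1 => x | _ => x ^+ 2 - 1 end.

Lemma measurable_hermite (R : realType) p :
  measurable_fun setT (@hermite R p).
Proof.
case: p => [|[|p]]; [exact: measurable_cst|exact: measurable_id|].
by apply: measurable_funB => //; exact: exprn_measurable.
Qed.

(** The mean of h_p h_q vanishes when exactly one of p and q is 0, and that is
all the orthogonality needed below: two multi-indices will always be compared at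
a coordinate where exactly one of them is 0. The bound V^p turns into a bound on
the second moment of a chaos in terms of its total degree alone. *)
Lemma normal_hermite_moments (R : realType) :
  exists (gam : nat -> nat -> R) (V : R), [/\ 1 <= V,
    forall p q, has_mean (@normal_prob R 0 1)
      (fun x => hermite p x * hermite q x) (gam p q),
    forall p q, (p == 0%N) != (q == 0%N) -> gam p q = 0 &
    forall p, gam p p <= V ^+ p].
Proof.
have h_bound p (x : R) : `|hermite p x| <= 1 + x ^+ 2.
  have x2 := sqr_ge0 x; have := sqr_ge0 (x - 1); have := sqr_ge0 (x + 1).
  case: p => [|[|p]] /= *; rewrite ler_norml; apply/andP; split; lra.
have hh p q : exists a, has_mean (@normal_prob R 0 1)
    (fun x => hermite p x * hermite q x) a.
  apply: (@normal_has_mean_bounded R _ 2).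
    by apply: measurable_funM; exact: measurable_hermite.
  move=> x; rewrite normrM.
  apply: (@le_trans _ _ ((1 + x ^+ 2) * (1 + x ^+ 2))); first exact: ler_pM.
  by have := sqr_ge0 (x ^+ 2 - 1) => *; lra.
have h0 p : (0 < p)%N -> has_mean (@normal_prob R 0 1) (hermite p) 0.
  case: p => [//|[|p]] _; first exact: normal_mean0.
  have := has_meanB (@normal_moment2 R) (has_mean_cst (@normal_prob R 0 1) 1).
  by rewrite subrr.
have /choice[gam0 hgam] : forall pq : nat * nat, exists a,
    has_mean (@normal_prob R 0 1)
      (fun x => hermite pq.1 x * hermite pq.2 x) a.
  by move=> [p q]; exact: hh.
exists (fun p q => gam0 (p, q)), (1 + `|gam0 (2%N, 2%N)|).
have one : gam0 (0%N, 0%N) = 1.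
  apply: has_mean_unique (hgam _) _; apply: eq_has_mean (has_mean_cst _ 1).
  by move=> x; rewrite mulr1.
split => //.
- by rewrite lerDl.
- by move=> p q; exact: (hgam (p, q)).
- move=> [|p] [|q]//= _; apply: (has_mean_unique (hgam _)).
  + by apply: eq_has_mean (h0 q.+1 isT) => x; rewrite mul1r.
  + by apply: eq_has_mean (h0 p.+1 isT) => x; rewrite mulr1.
- move=> [|[|p]]; first by rewrite one expr0.
    have -> : gam0 (1%N, 1%N) = 1.
      by apply: has_mean_unique (hgam _) _; exact: normal_moment2.
    by rewrite expr1 lerDl.
  have -> : gam0 (p.+2, p.+2) = gam0 (2%N, 2%N).
    exact: has_mean_unique (hgam (p.+2, p.+2)) (hgam (2%N, 2%N)).
  rewrite exprS (le_trans (ler_norm _))//.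
  apply: (@le_trans _ _ (1 + `|gam0 (2%N, 2%N)|)); first by rewrite lerDr.
  by rewrite ler_peMr ?addr_ge0// exprn_ege1// lerDl.
Qed.

(** * Orthogonality of the Gaussian chaos *)

(** The multi-index of the monomial eps_i eps_j, so that the diagonal pair (i,
i) gives the Hermite polynomial of degree 2. *)
Definition pair_index n (p : 'I_n * 'I_n) (r : nat) : nat :=
  ((r == p.1) + (r == p.2))%N.

(** For ordered pairs the supports {i, j} and {k, l} differ. The smaller of two
distinct minima, or else the larger of two distinct maxima, belongs to one
support and not to the other. *)
Lemma pair_index_separated n (p q : 'I_n * 'I_n) :
  (p.1 <= p.2)%N -> (q.1 <= q.2)%N -> p != q ->
  exists r : 'I_n, (pair_index p r == 0%N) != (pair_index q r == 0%N).
Proof.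
have E (r a b : nat) : (((r == a) + (r == b))%N == 0%N) = (r != a) && (r != b).
  by case: (r == a); case: (r == b).
case: p q => [i j] [k l]; rewrite /pair_index /= => ij kl pq.
have [ik|ki|ik] := ltngtP i k.
- exists i; rewrite !E eqxx /= !neq_ltn ik.
  by rewrite (leq_trans ik kl).
- exists k; rewrite !E eqxx /= !neq_ltn ki.
  by rewrite (leq_trans ki ij).
have [jl|lj|jl] := ltngtP j l.
- exists l; rewrite !E eqxx /= andbF !neq_ltn jl orbT.
  by rewrite (leq_ltn_trans ij jl) orbT.
- exists j; rewrite !E eqxx /= andbF !neq_ltn lj orbT.
  by rewrite (leq_ltn_trans kl lj) orbT.
by case/eqP: pq; congr pair; apply/val_inj.
Qed.

Lemma sum_ord_delta n (i : 'I_n) : (\sum_(r < n) (r == i :> nat))%N = 1%N.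
Proof.
rewrite (bigD1 i)//= eqxx big1// => r /eqP ri.
by apply/eqP; rewrite eqb0; apply/eqP => /val_inj.
Qed.

Lemma sqr_sum3 (R : realFieldType) (x y z : R) :
  (x + (y + z)) ^+ 2 <= 3 * (x ^+ 2 + (y ^+ 2 + z ^+ 2)).
Proof.
have := sqr_ge0 (x - y); have := sqr_ge0 (y - z); have := sqr_ge0 (x - z).
by move=> *; lra.
Qed.

Section gaussian_chaos.
Context d (T : measurableType d) (R : realType) (P : probability T R).
Variable eps : nat -> {RV P >-> R}.
Hypothesis eps_law : forall i B, measurable B ->
  distribution P (eps i) B = normal_prob 0 1 B.
Hypothesis eps_indep : forall n (B : nat -> set R),
  (forall i, measurable (B i)) ->
  (P [set w | forall i, (i < n)%N -> B i (eps i w)] =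
   \prod_(i < n) P (eps i @^-1` B i))%E.
Variables (gam : nat -> nat -> R) (V : R).
Hypotheses (V1 : 1 <= V)
  (gamP : forall p q, has_mean (@normal_prob R 0 1)
      (fun x => hermite p x * hermite q x) (gam p q))
  (gam0 : forall p q, (p == 0%N) != (q == 0%N) -> gam p q = 0)
  (gam_le : forall p, gam p p <= V ^+ p).
Variable n : nat.

Definition chaos (a : nat -> nat) (w : T) : R :=
  \prod_(r < n) hermite (a r) (eps r w).

Lemma chaosM_has_mean a b :
  has_mean P (fun w => chaos a w * chaos b w) (\prod_(r < n) gam (a r) (b r)).
Proof.
have mE i : measurable_fun setT (eps i) by exact: measurable_funP.
pose g i (x : R) := hermite (a i) x * hermite (b i) x : R.
have mg i : measurable_fun setT (g i).
  by apply: measurable_funM; exact: measurable_hermite.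
have := @independent_prod_has_mean _ _ _ P (fun i => eps i) mE eps_indep n g
  (fun i => gam (a i) (b i)) mg.
have -> : (fun w => \prod_(i < n) g i (eps i w)) =
    (fun w => chaos a w * chaos b w).
  by apply/funext => w; rewrite /chaos -big_split.
apply => i _.
exact: has_mean_distribution (eps_law i) (mg i) (gamP (a i) (b i)).
Qed.

(** Pythagoras: a cross term contains a factor E h_p h_q with exactly one of p,
q equal to 0, which vanishes. *)
Lemma orthogonal_chaos_sum (I : finType) (Q : pred I) (al : I -> nat -> nat)
    (c : I -> R) (D : nat) :
  (forall i j, Q i -> Q j -> i != j ->
     exists r : 'I_n, (al i r == 0%N) != (al j r == 0%N)) ->
  (forall i, Q i -> (\sum_(r < n) al i r <= D)%N) ->
  exists2 v, has_mean P (fun w => (\sum_(i | Q i) c i * chaos (al i) w) ^+ 2) v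
    & v <= V ^+ D * \sum_(i | Q i) c i ^+ 2.
Proof.
move=> sep deg; pose G i j := \prod_(r < n) gam (al i r) (al j r).
exists (\sum_(i | Q i) \sum_(j | Q j) (c i * c j) * G i j).
  have := has_mean_sum (index_enum I) Q (fun i =>
    has_mean_sum (index_enum I) Q (fun j =>
      has_meanZ (c i * c j) (chaosM_has_mean (al i) (al j)))).
  apply: eq_has_mean => w; rewrite expr2 mulr_suml; apply: eq_bigr => i _.
  by rewrite mulr_sumr; apply: eq_bigr => j _; rewrite mulrACA.
rewrite mulr_sumr ler_sum// => i Qi.
rewrite (bigD1 i)//= big1 ?addr0 => [|j /andP[Qj ji]]; last first.
  have [|r rij] := sep i j Qi Qj; first by rewrite eq_sym.
  by rewrite /G (bigD1 r)//= gam0// mul0r mulr0.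
rewrite mulrC -expr2 ler_wpM2r ?sqr_ge0//.
have gam_ge0 p : 0 <= gam p p.
  apply: (le_has_mean _ (has_mean_cst _ 0) (gamP p p)) => x.
  by rewrite -expr2 sqr_ge0.
apply: (@le_trans _ _ (\prod_(r < n) V ^+ al i r)).
  by apply: ler_prod => r _; rewrite gam_ge0 gam_le.
by rewrite -expr_sum ler_weXn2l// deg.
Qed.

Lemma chaos_delta (i : 'I_n) w : chaos (fun r => r == i) w = eps i w.
Proof.
rewrite /chaos (bigD1 i)//= eqxx big1 ?mulr1// => r ri.
by rewrite (_ : (val r == i) = false)//; exact/negbTE.
Qed.

Lemma chaos_pair (p : 'I_n * 'I_n) w :
  chaos (pair_index p) w = eps p.1 w * eps p.2 w - (p.1 == p.2)%:R.
Proof.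
case: p => i j; rewrite /chaos /pair_index /=.
have neq (r k : 'I_n) : r != k -> (val r == val k) = false by move=> /negbTE.
rewrite (bigD1 i)//= eqxx; have [<-|ij] := eqVneq i j.
  rewrite eqxx big1 ?mulr1 ?expr2// => r ri.
  by rewrite neq.
have ji : j != i by rewrite eq_sym.
rewrite (neq _ _ ij) /= (bigD1 j)//= eqxx (neq _ _ ji) /=.
rewrite big1 ?mulr1 ?subr0// => r /andP[ri rj].
by rewrite !neq.
Qed.

Definition noise_form (c : 'I_n -> R) (B : 'I_n -> 'I_n -> R) (w : T) : R :=
  \sum_i c i * eps i w +
  \sum_i \sum_j B i j * (eps i w * eps j w - (i == j)%:R).

Lemma measurable_noise_form (c : 'I_n -> R) (B : 'I_n -> 'I_n -> R) :
  measurable_fun setT (noise_form c B).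
Proof.
have me i : measurable_fun setT (eps i) by exact: measurable_funP.
apply: measurable_funD.
  by apply: measurable_sum => i; apply: measurable_funM.
apply: measurable_sum => i; apply: measurable_sum => j.
apply: measurable_funM => //; apply: measurable_funB => //.
exact: measurable_funM.
Qed.

(** The linear part, the part over i <= j and the part over i > j are each sums
of pairwise orthogonal chaoses of degree at most 2, so each second moment is at
most V^2 times a sum of squared coefficients. The whole family over ordered
pairs is not orthogonal, because (i, j) and (j, i) give the same chaos. *)
Lemma noise_form_tail (c : 'I_n -> R) (B : 'I_n -> 'I_n -> R) (t : R) : 0 < t ->
  (P [set w | (t <= `|noise_form c B w|)%R] <=
   (3 * V ^+ 2 * (\sum_i c i ^+ 2 + \sum_i \sum_j B i j ^+ 2) / t ^+ 2)%:E)%E.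
Proof.
move=> t0.
have V0 : 0 <= V by apply: le_trans V1.
pose be (p : 'I_n * 'I_n) := B p.1 p.2.
have [|i _|vL mL leL] := @orthogonal_chaos_sum 'I_n predT
    (fun i r => nat_of_bool (r == i)) c 2.
- move=> i j _ _ ij; exists i; rewrite eqxx /=.
  by rewrite (_ : (val i == j) = false)//; exact/negbTE.
- by rewrite sum_ord_delta.
have deg (p : 'I_n * 'I_n) : (\sum_(r < n) pair_index p r <= 2)%N.
  by rewrite /pair_index big_split /= (sum_ord_delta p.1) (sum_ord_delta p.2).
have [p q|p _|vU mU leU] := @orthogonal_chaos_sum ('I_n * 'I_n)%type
    (fun p => p.1 <= p.2)%N (@pair_index n) be 2.
- exact: pair_index_separated.
- exact: deg.
have [p q pp qq pq|p _|vD mD leD] := @orthogonal_chaos_sum ('I_n * 'I_n)%type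
    (fun p => ~~ (p.1 <= p.2)%N) (@pair_index n) be 2.
- have sw (u : 'I_n * 'I_n) r : pair_index (u.2, u.1) r = pair_index u r.
    by rewrite /pair_index /= addnC.
  have [|||r] := @pair_index_separated n (p.2, p.1) (q.2, q.1).
  + by rewrite /= ltnW// ltnNge.
  + by rewrite /= ltnW// ltnNge.
  + apply: contra pq => /eqP[e2 e1].
    by rewrite [p]surjective_pairing e1 e2 -surjective_pairing.
  by rewrite !sw => ?; exists r.
- exact: deg.
have mS := has_meanZ 3 (has_meanD mL (has_meanD mU mD)).
set F := (F in has_mean P F _) in mS.
have F0 w : 0 <= F w by rewrite /F mulr_ge0// !addr_ge0 ?sqr_ge0.
have t20 : 0 < t ^+ 2 by rewrite exprn_gt0.
have formE w : noise_form c B w = \sum_i c i * chaos (fun r => r == i) w +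
   (\sum_(p : 'I_n * 'I_n | (p.1 <= p.2)%N) be p * chaos (pair_index p) w +
   \sum_(p : 'I_n * 'I_n | ~~ (p.1 <= p.2)%N) be p * chaos (pair_index p) w).
  rewrite /noise_form; congr (_ + _).
    by apply: eq_bigr => i _; rewrite chaos_delta.
  rewrite pair_bigA /= (bigID (fun p : 'I_n * 'I_n => p.1 <= p.2)%N) /=.
  by congr (_ + _); apply: eq_bigr => p _; rewrite chaos_pair.
have sub : [set w | t <= `|noise_form c B w|] `<=` [set w | t ^+ 2 <= F w].
  move=> w /= tZ; apply: (@le_trans _ _ (noise_form c B w ^+ 2)).
    rewrite -[leRHS]real_normK ?num_real// lerXn2r ?nnegrE// ltW//.
  by rewrite formE; exact: sqr_sum3.
have mF := has_mean_measurable mS.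
have mZ := measurable_noise_form c B.
apply: le_trans (le_trans _ (markov_has_mean t20 F0 mS)) _.
  apply: le_measure; rewrite ?inE//.
  - rewrite -[X in measurable X]setTI; apply: measurable_fun_le => //.
    exact: measurableT_comp.
  - by rewrite -[X in measurable X]setTI; exact: measurable_fun_le.
rewrite lee_fin ler_pM2r ?invr_gt0// -mulrA ler_wpM2l//.
have -> : \sum_i \sum_j B i j ^+ 2 =
    \sum_(p : 'I_n * 'I_n | (p.1 <= p.2)%N) be p ^+ 2 +
    \sum_(p : 'I_n * 'I_n | ~~ (p.1 <= p.2)%N) be p ^+ 2.
  by rewrite pair_bigA /= (bigID (fun p : 'I_n * 'I_n => p.1 <= p.2)%N) /=.
by rewrite !mulrDr !lerD.
Qed.

End gaussian_chaos.

(** * Gradient descent in the eigenbasis *)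

Lemma sum_sqr_orthogonal (R : realType) n (U : 'M[R]_n) (v : 'cV[R]_n) :
  U *m U^T = 1%:M -> \sum_i (U^T *m v) i 0 ^+ 2 = \sum_i v i 0 ^+ 2.
Proof.
have sqrE (u : 'cV[R]_n) : \sum_i u i 0 ^+ 2 = (u^T *m u) 0 0.
  by rewrite mxE; apply: eq_bigr => i _; rewrite mxE expr2.
move=> UU; rewrite !sqrE trmx_mul trmxK mulmxA -(mulmxA v^T) UU mulmx1.
by [].
Qed.

Section shrinkage.
Context {R : realType} (alpha : nat -> R) {n : nat} (muhat : 'rV[R]_n).

Definition shrink_factor (t : nat) (k : 'I_n) : R :=
  \prod_(tau < t) (1 - alpha tau * muhat 0 k).

Lemma shrink_factorS t k : shrink_factor t.+1 k =
  shrink_factor t k * (1 - alpha t * muhat 0 k).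
Proof. by rewrite /shrink_factor big_ord_recr. Qed.

Lemma shrinkage_diag t :
  1%:M - shrinkage alpha muhat t = diag_mx (\row_k (1 - shrink_factor t k)).
Proof.
have -> : shrinkage alpha muhat t = diag_mx (\row_k shrink_factor t k).
  rewrite /shrinkage; elim: t => [|t IH].
    rewrite big_ord0; apply/matrixP => i j.
    by rewrite !mxE /shrink_factor big_ord0.
  rewrite big_ord_recr /= IH; apply/matrixP => i j.
  rewrite -[LHS]/((_ *m _) i j) mul_diag_mx !mxE shrink_factorS.
  by case: eqVneq => [->|ij]; rewrite ?mulr1n ?mulr0n ?mulr0 ?subr0 ?mulr0.
apply/matrixP => i j; rewrite !mxE.
by case: eqVneq => _; rewrite ?mulr1n ?mulr0n ?subr0.
Qed.

Lemma mxtrace_exp_diag (v : 'rV[R]_n) p :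
  \tr (diag_mx v ^+ p) = \sum_k v 0 k ^+ p.
Proof.
have -> : diag_mx v ^+ p = diag_mx (\row_k v 0 k ^+ p).
  elim: p => [|p IH].
    by apply/matrixP => i j; rewrite expr0 !mxE expr0.
  rewrite exprS IH; apply/matrixP => i j.
  rewrite -[LHS]/((_ *m _) i j) mul_diag_mx !mxE.
  by case: eqVneq => [->|ij]; rewrite ?mulr1n ?mulr0n ?mulr0 ?exprS.
by rewrite mxtrace_diag; apply: eq_bigr => k _; rewrite mxE.
Qed.

Lemma mean_H0E t : mean_H0 alpha muhat t =
  n%:R^-1 * \sum_k (1 - shrink_factor t k) ^+ 2.
Proof.
rewrite /mean_H0 shrinkage_diag mxtrace_exp_diag; congr (_ * _).
by apply: eq_bigr => k _; rewrite mxE.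
Qed.

Lemma sqr_sd_H0 t : sd_H0 alpha muhat t ^+ 2 =
  2 / n%:R ^+ 2 * \sum_k (1 - shrink_factor t k) ^+ 4.
Proof.
rewrite /sd_H0 shrinkage_diag mxtrace_exp_diag.
rewrite (eq_bigr (fun k => (1 - shrink_factor t k) ^+ 4)) => [|k _]; last first.
  by rewrite mxE.
rewrite sqr_sqrtr// mulr_ge0 ?divr_ge0 ?exprn_ge0//.
by apply: sumr_ge0 => k _; rewrite exprn_even_ge0.
Qed.

(** In the eigenbasis the recursion is f' = f - alpha mu (f - y) coordinatewise,
so the residual f - y is multiplied by 1 - alpha mu at each step. *)
Lemma gd_fit_coordinates (U Kn : 'M[R]_n) (y : 'cV[R]_n) t k :
  Kn = U *m diag_mx muhat *m U^T -> U *m U^T = 1%:M ->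
  (U^T *m gd_fit alpha Kn y t) k 0 =
  (1 - shrink_factor t k) * (U^T *m y) k 0.
Proof.
move=> KE /mulmx1C UU.
have KvE (v : 'cV[R]_n) : U^T *m (Kn *m v) = diag_mx muhat *m (U^T *m v).
  by rewrite KE !mulmxA UU mul1mx.
elim: t => [|t IH] /=.
  by rewrite mulmx0 mxE /shrink_factor big_ord0 subrr mul0r.
rewrite mulmxBr -scalemxAr KvE mulmxBr mul_diag_mx.
move: (U^T *m gd_fit alpha Kn y t) (U^T *m y) IH => G z IH.
by rewrite !mxE IH shrink_factorS; ring.
Qed.

(** By induction: 1 - b <= 1 / (1 + b), so the product of the factors 1 - b_tau
is at most 1 / (1 + sum_tau b_tau). *)
Lemma shrink_factor_bounds t k :
  (forall tau, 0 <= alpha tau * muhat 0 k <= 1) ->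
  [/\ 0 <= shrink_factor t k, shrink_factor t k <= 1 &
      shrink_factor t k * (1 + total_step alpha t * muhat 0 k) <= 1].
Proof.
move=> H; elim: t => [|t [s0 s1 IH]].
  by rewrite /shrink_factor /total_step !big_ord0 mul0r addr0 mulr1 ler01 lexx.
have /andP[a0 a1] := H t; have ha : 0 <= 1 - alpha t * muhat 0 k by lra.
rewrite shrink_factorS /total_step big_ord_recr /= -/(total_step alpha t).
have eta0 : 0 <= total_step alpha t * muhat 0 k.
  rewrite /total_step mulr_suml sumr_ge0// => tau _.
  by have /andP[] := H tau.
set s := shrink_factor t k in s0 s1 IH *.
set e := total_step alpha t in IH eta0 *.
set b := alpha t * muhat 0 k in a0 a1 ha *.
rewrite mulr_ge0//; split => //.
  by rewrite mulr_ile1//; lra.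
apply: le_trans IH; rewrite -mulrA ler_wpM2l//.
rewrite (_ : (e + alpha t) * muhat 0 k = e * muhat 0 k + b); last exact: mulrDl.
have := mulr_ge0 a0 eta0; have := sqr_ge0 b.
by move=> *; lra.
Qed.

End shrinkage.

(** * The statistic as a quadratic form in the noise *)

Section quadratic_statistic.
Context {R : realType} {n : nat} (U : 'M[R]_n) (q : 'I_n -> R) (v : 'cV[R]_n).
Hypothesis UU : U *m U^T = 1%:M.

Definition signal_energy : R := \sum_k q k ^+ 2 * (U^T *m v) k 0 ^+ 2.

Definition linear_weight (i : 'I_n) : R :=
  \sum_k U i k * (2 * q k ^+ 2 * (U^T *m v) k 0).

Definition quadratic_weight (i j : 'I_n) : R :=
  \sum_k U j k * (q k ^+ 2 * U i k).

Let sum_sqr_mul (w : 'I_n -> R) :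
  \sum_i (\sum_k U i k * w k) ^+ 2 = \sum_k w k ^+ 2.
Proof.
have UU' : U^T *m U^T^T = 1%:M by rewrite trmxK; exact: mulmx1C.
have := sum_sqr_orthogonal (\col_k w k) UU'; rewrite trmxK => H.
transitivity (\sum_k (\col_k w k) k 0 ^+ 2); last first.
  by apply: eq_bigr => k _; rewrite mxE.
rewrite -H; apply: eq_bigr => i _; rewrite mxE; congr (_ ^+ 2).
by apply: eq_bigr => k _; rewrite mxE.
Qed.

Let col_norm k : \sum_i U i k ^+ 2 = 1.
Proof.
have /matrixP/(_ k k) := mulmx1C UU; rewrite !mxE eqxx => H; apply: etrans H.
by apply: eq_bigr => i _; rewrite mxE expr2.
Qed.

Lemma sum_sqr_linear_weight : (forall k, 0 <= q k <= 1) ->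
  \sum_i linear_weight i ^+ 2 <= 4 * signal_energy.
Proof.
move=> q01; rewrite sum_sqr_mul /signal_energy mulr_sumr ler_sum// => k _.
have /andP[q0 q1] := q01 k; set g := (U^T *m v) k 0.
have -> : (2 * q k ^+ 2 * g) ^+ 2 = q k ^+ 2 * (4 * (q k ^+ 2 * g ^+ 2)).
  by ring.
by rewrite ler_piMl ?exprn_ile1// mulr_ge0// mulr_ge0 ?sqr_ge0.
Qed.

Lemma sum_sqr_quadratic_weight :
  \sum_i \sum_j quadratic_weight i j ^+ 2 = \sum_k q k ^+ 4.
Proof.
under eq_bigr do rewrite sum_sqr_mul.
rewrite exchange_big /=; apply: eq_bigr => k _.
under eq_bigr do rewrite exprMn.
by rewrite -mulr_sumr col_norm mulr1 -exprM.
Qed.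

(** Expand the square; the term without noise is the signal, and sum_i U_ik^2 =
1 centres the quadratic part. *)
Lemma quadratic_statistic_split (e : 'cV[R]_n) :
  \sum_k (q k * (U^T *m (v + e)) k 0) ^+ 2 - \sum_k q k ^+ 2 =
  signal_energy + (\sum_i linear_weight i * e i 0 +
    \sum_i \sum_j quadratic_weight i j * (e i 0 * e j 0 - (i == j)%:R)).
Proof.
pose E k := \sum_i U i k * e i 0.
have linE : \sum_i linear_weight i * e i 0 =
    \sum_k 2 * q k ^+ 2 * (U^T *m v) k 0 * E k.
  under eq_bigr do rewrite mulr_suml.
  rewrite exchange_big /=; apply: eq_bigr => k _.
  by rewrite /E mulr_sumr; apply: eq_bigr => i _; ring.
have sqrE k : E k ^+ 2 - 1 =
    \sum_i \sum_j U j k * U i k * (e i 0 * e j 0 - (i == j)%:R).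
  have diagE i : \sum_j U j k * U i k * (e i 0 * e j 0 - (i == j)%:R) =
      (\sum_j U j k * U i k * (e i 0 * e j 0)) - U i k ^+ 2.
    rewrite -(eq_bigr _ (fun j _ => esym (mulrBr _ _ _))) sumrB; congr (_ - _).
    rewrite (bigD1 i)//= eqxx mulr1 -expr2 big1 ?addr0// => j ji.
    by rewrite eq_sym (negbTE ji) mulr0.
  under [RHS]eq_bigr do rewrite diagE.
  rewrite sumrB col_norm expr2 /E mulr_suml; congr (_ - _).
  by apply: eq_bigr => i _; rewrite mulr_sumr; apply: eq_bigr => j _; ring.
have quadE : \sum_i \sum_j quadratic_weight i j * (e i 0 * e j 0 - (i == j)%:R)
    = \sum_k q k ^+ 2 * (E k ^+ 2 - 1).
  under [RHS]eq_bigr do rewrite sqrE mulr_sumr.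
  rewrite [RHS]exchange_big /=; apply: eq_bigr => i _.
  under [RHS]eq_bigr do rewrite mulr_sumr.
  rewrite [RHS]exchange_big /=; apply: eq_bigr => j _.
  by rewrite /quadratic_weight mulr_suml; apply: eq_bigr => k _; ring.
rewrite linE quadE /signal_energy -!big_split -sumrB /=; apply: eq_bigr => k _.
have -> : (U^T *m (v + e)) k 0 = (U^T *m v) k 0 + E k.
  rewrite mulmxDr mxE; congr (_ + _).
  by rewrite mxE; apply: eq_bigr => i _; rewrite mxE.
ring.
Qed.

End quadratic_statistic.

(** * Evaluation bounds in the reproducing kernel Hilbert space *)

Section rkhs.
Context {R : realType} {d : nat}.
Local Notation E := (d.-tuple R).
Variables (XX : set E) (K : E -> E -> R) (H : set (E -> R))
  (ip : (E -> R) -> (E -> R) -> R).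
Hypothesis HK : is_rkhs XX K H ip.

Lemma rkhs_ip0 g : H g -> ip (fun=> 0) g = 0.
Proof.
move=> Hg; have H0 := rkhs_zero HK.
have := rkhs_ip_lin HK (-1) H0 H0 Hg.
rewrite (_ : (fun=> _) = (fun=> 0)).
  by rewrite mulN1r addNr.
by apply/funext => x; rewrite mulr0 addr0.
Qed.

(** The discriminant argument, with f = 0 when ip f f = 0. *)
Lemma rkhs_cauchy_schwarz f h : H f -> H h ->
  ip f h ^+ 2 <= ip f f * ip h h.
Proof.
move=> Hf Hh; have lin := rkhs_ip_lin HK.
have quad t : 0 <= t ^+ 2 * ip f f + 2 * t * ip f h + ip h h.
  have Hg := rkhs_lin HK t Hf Hh.
  have := rkhs_ip_ge0 HK Hg; rewrite lin//.
  rewrite (rkhs_ip_sym HK Hf Hg) (rkhs_ip_sym HK Hh Hg) !lin//.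
  by rewrite (rkhs_ip_sym HK Hh Hf) => ?; lra.
have [f0|f0] := eqVneq (ip f f) 0.
  have fz := rkhs_ip_eq0 HK Hf f0.
  rewrite fz rkhs_ip0// expr0n /= mulr_ge0 ?(rkhs_ip_ge0 HK)//.
  exact: (rkhs_zero HK).
have fp : 0 < ip f f by rewrite lt_neqAle eq_sym f0 (rkhs_ip_ge0 HK).
(* apply the quadratic at its vertex *)
have := quad (- ip f h / ip f f); rewrite -(pmulr_rge0 _ fp).
set a := ip f f in f0 fp *; set b := ip f h; set c := ip h h.
have -> : a * ((- b / a) ^+ 2 * a + 2 * (- b / a) * b + c) = a * c - b ^+ 2.
  by field.
by rewrite subr_ge0.
Qed.

Lemma rkhs_kernel_sum (I : Type) (s : seq I) (a : I -> R) (x : I -> E) :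
  (forall i, XX (x i)) ->
  H (fun y => \sum_(i <- s) a i * K (x i) y) /\
  (forall g, H g ->
    ip (fun y => \sum_(i <- s) a i * K (x i) y) g =
    \sum_(i <- s) a i * g (x i)).
Proof.
move=> Xx; elim: s => [|i s [IH1 IH2]].
  have -> : (fun y => \sum_(i <- [::]) a i * K (x i) y) = (fun=> 0).
    by apply/funext => y; rewrite big_nil.
  by split=> [|g Hg]; [exact: (rkhs_zero HK)|rewrite rkhs_ip0// big_nil].
have -> : (fun y => \sum_(j <- i :: s) a j * K (x j) y) =
    (fun y => a i * K (x i) y + (fun y => \sum_(j <- s) a j * K (x j) y) y).
  by apply/funext => y; rewrite big_cons.
have HKi := rkhs_section HK (Xx i).
split; first exact: (rkhs_lin HK).
move=> g Hg; rewrite (rkhs_ip_lin HK)// IH2// big_cons; congr (_ * _ + _).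
by rewrite (rkhs_ip_sym HK)// (rkhs_reproducing HK).
Qed.

Lemma rkhs_evaluation_bound n (a : 'I_n -> R) (x : 'I_n -> E) f :
  (forall i, XX (x i)) -> H f ->
  (\sum_i a i * f (x i)) ^+ 2 <=
  ip f f * \sum_i a i * \sum_j a j * K (x j) (x i).
Proof.
move=> Xx Hf; have [Hh ipE] := @rkhs_kernel_sum _ (index_enum 'I_n) a x Xx.
have := rkhs_cauchy_schwarz Hf Hh.
by rewrite (rkhs_ip_sym HK Hf Hh) !ipE.
Qed.

Section coordinates.
Context {n : nat} (x : 'I_n -> E) (U : 'M[R]_n) (muhat : 'rV[R]_n).
Hypotheses (n_gt0 : (0 < n)%N) (Xx : forall i, XX (x i)).
Hypothesis spec : spectral_decomposition (kernel_mx K x) U muhat.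

(** The combination sum_i a_i f(x_i) is the inner product of f with sum_i a_i
K(x_i, .), whose squared norm is a quadratic form in the kernel matrix; with a =
U b this form is diagonal. *)
Lemma coordinate_evaluation_bound f (b : 'I_n -> R) : H f ->
  (\sum_k b k * (U^T *m values x f) k 0) ^+ 2 <=
  ip f f * (n%:R * \sum_k muhat 0 k * b k ^+ 2).
Proof.
move=> Hf; case: spec => KE UU _ _.
pose a i := \sum_k U i k * b k.
have -> : \sum_k b k * (U^T *m values x f) k 0 = \sum_i a i * f (x i).
  under eq_bigr do rewrite mxE mulr_sumr.
  rewrite exchange_big /=; apply: eq_bigr => i _.
  by rewrite mulr_suml; apply: eq_bigr => k _; rewrite !mxE; ring.
suff <- : \sum_i a i * \sum_j a j * K (x j) (x i) =
    n%:R * \sum_k muhat 0 k * b k ^+ 2 by exact: rkhs_evaluation_bound.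
have n0 : n%:R != 0 :> R by rewrite pnatr_eq0 -lt0n.
have KxE i j : K (x j) (x i) = n%:R * \sum_k U j k * muhat 0 k * U i k.
  have /matrixP/(_ j i) := KE; rewrite !mxE => Kji.
  have -> : K (x j) (x i) = n%:R * (n%:R^-1 * K (x j) (x i)) by rewrite mulVKf.
  rewrite Kji; congr (_ * _); apply: eq_bigr => k _.
  by rewrite mul_mx_diag !mxE.
have aU k : \sum_i a i * U i k = b k.
  have UUT : U^T *m U = 1%:M by exact: mulmx1C.
  have /matrixP/(_ k 0) : U^T *m (U *m \col_k b k) = \col_k b k.
    by rewrite mulmxA UUT mul1mx.
  rewrite [RHS]mxE => <-; rewrite mxE; apply: eq_bigr => i _.
  rewrite !mxE mulrC; congr (_ * _).
  by rewrite /a; apply: eq_bigr => l _; rewrite mxE.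
transitivity (n%:R * \sum_k muhat 0 k *
    ((\sum_i a i * U i k) * (\sum_j a j * U j k))).
  rewrite mulr_sumr; under [RHS]eq_bigr do rewrite mulr_suml !mulr_sumr.
  rewrite [RHS]exchange_big /=; apply: eq_bigr => i _.
  under [RHS]eq_bigr do rewrite !mulr_sumr.
  rewrite [RHS]exchange_big /= mulr_sumr; apply: eq_bigr => j _.
  rewrite KxE !mulr_sumr; apply: eq_bigr => k _; ring.
by congr (_ * _); apply: eq_bigr => k _; rewrite !aU expr2.
Qed.

(** Take b_k = s_k^2 g_k in [coordinate_evaluation_bound]: the sum W to be
bounded then satisfies W^2 <= ip f f * n * M * W. *)
Lemma weighted_coordinates_bound f (s : 'I_n -> R) (M : R) : H f -> 0 <= M ->
  (forall k, muhat 0 k * s k ^+ 2 <= M) ->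
  \sum_k s k ^+ 2 * (U^T *m values x f) k 0 ^+ 2 <= ip f f * (n%:R * M).
Proof.
move=> Hf M0 sM; set g := U^T *m values x f; set W := \sum_k _.
have W0 : 0 <= W by apply: sumr_ge0 => k _; rewrite mulr_ge0 ?sqr_ge0.
have f0 : 0 <= ip f f by exact: (rkhs_ip_ge0 HK).
have := coordinate_evaluation_bound (fun k => s k ^+ 2 * g k 0) Hf.
rewrite -/g (eq_bigr (fun k => s k ^+ 2 * g k 0 ^+ 2)) => [|k _]; last by ring.
rewrite -/W => WW.
have : W ^+ 2 <= ip f f * (n%:R * M) * W.
  apply: (le_trans WW); rewrite -!mulrA ler_wpM2l// ler_wpM2l//.
  rewrite /W mulr_sumr ler_sum// => k _.
  have -> : (s k ^+ 2 * g k 0) ^+ 2 = s k ^+ 2 * (s k ^+ 2 * g k 0 ^+ 2).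
    by ring.
  by rewrite mulrA ler_wpM2r// mulr_ge0 ?sqr_ge0.
have [->|Wn0] := eqVneq W 0; first by rewrite !mulr_ge0.
by rewrite expr2 ler_pM2r// lt_neqAle eq_sym Wn0.
Qed.

End coordinates.
End rkhs.

(** * Signal and scale of the statistic under separation *)

Section signal.
Context {R : realType} {d : nat}.
Local Notation E := (d.-tuple R).
Variables (XX : set E) (K : E -> E -> R) (H : set (E -> R))
  (ip : (E -> R) -> (E -> R) -> R).
Hypothesis HK : is_rkhs XX K H ip.
Variables (n : nat) (x : 'I_n -> E) (U : 'M[R]_n) (muhat : 'rV[R]_n).
Hypotheses (n_gt0 : (0 < n)%N) (Xx : forall i, XX (x i)).
Hypothesis spec : spectral_decomposition (kernel_mx K x) U muhat.
Variables (alpha : nat -> R) (t : nat).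
Hypothesis step : forall tau k, 0 <= alpha tau * muhat 0 k <= 1.
Local Notation eta := (total_step alpha t).
Hypothesis eta_gt0 : 0 < eta.
Variables (f : E -> R) (C Ce : R).
Hypotheses (Hf : H f) (C0 : 0 <= C) (fC : rkhs_norm ip f <= C) (Ce0 : 0 <= Ce).
Hypothesis sep : Ce * sep_rate alpha muhat t <= emp_norm (values x f).
Hypothesis CeC : 2 * C ^+ 2 < Ce ^+ 2.

Let s := shrink_factor alpha muhat t.
Let g := U^T *m values x f.
Let F := \sum_k g k 0 ^+ 2.
Let sigma := sd_H0 alpha muhat t.

Lemma ip_le_sqr : ip f f <= C ^+ 2.
Proof.
by rewrite -[ip f f]sqr_sqrtr ?(rkhs_ip_ge0 HK)// lerXn2r// nnegrE// sqrtr_ge0.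
Qed.

Lemma sqr_emp_norm (v : 'cV[R]_n) :
  emp_norm v ^+ 2 = n%:R^-1 * \sum_i v i 0 ^+ 2.
Proof.
rewrite sqr_sqrtr// mulr_ge0 ?invr_ge0//.
by apply: sumr_ge0 => i _; rewrite sqr_ge0.
Qed.

Let nR_gt0 : 0 < n%:R :> R. Proof. by rewrite ltr0n. Qed.

Let separation : Ce ^+ 2 * (n%:R / eta + n%:R * sigma) <= F.
Proof.
have : (Ce * sep_rate alpha muhat t) ^+ 2 <= emp_norm (values x f) ^+ 2.
  by rewrite lerXn2r// nnegrE ?mulr_ge0 ?sqrtr_ge0.
have [_ UU _ _] := spec.
rewrite sqr_emp_norm -(sum_sqr_orthogonal (values x f) UU) -/F exprMn.
rewrite [sep_rate _ _ _ ^+ 2]sqr_sqrtr; last first.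
  by rewrite addr_ge0 ?sqrtr_ge0// invr_ge0 ltW.
rewrite -(ler_pM2l nR_gt0) mulVKf ?gt_eqF//; apply: le_trans.
by rewrite [leRHS]mulrCA [n%:R * (_ + _)]mulrDr.
Qed.

Let biasE (M : R) (r : 'I_n -> R) : 0 <= M ->
  (forall k, muhat 0 k * r k ^+ 2 <= M) ->
  \sum_k r k ^+ 2 * g k 0 ^+ 2 <= C ^+ 2 * (n%:R * M).
Proof.
move=> M0 rM.
apply: le_trans (weighted_coordinates_bound HK n_gt0 Xx spec Hf M0 rM) _.
by rewrite ler_wpM2r ?ip_le_sqr// mulr_ge0.
Qed.

Let mu0 k : 0 <= muhat 0 k. Proof. by case: spec. Qed.

Let shrink_bias : \sum_k s k ^+ 2 * g k 0 ^+ 2 <= C ^+ 2 * (n%:R / eta).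
Proof.
apply: biasE => [|k]; first by rewrite invr_ge0 ltW.
have [s0 s1 sm] := shrink_factor_bounds t (fun tau => step tau k).
rewrite -[leRHS]mul1r ler_pdivlMr//.
apply: (@le_trans _ _ (s k * (eta * muhat 0 k))); last first.
  by apply: le_trans sm; rewrite ler_wpM2l// lerDr.
rewrite -/s in s0 s1 *; have : s k ^+ 2 <= s k by rewrite expr2 ler_piMl.
move=> ss; rewrite (_ : _ * eta = s k ^+ 2 * (eta * muhat 0 k)); last by ring.
by rewrite ler_wpM2r// mulr_ge0// ltW.
Qed.

(** By g_k^2 <= 2 q_k^2 g_k^2 + 2 s_k^2 g_k^2, the energy is at least half of n
||f||_n^2 minus the discarded part, which costs at most C^2 n / eta and is
absorbed by the term 1 / eta of the separation rate. *)
Lemma signal_energy_bound :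
  Ce ^+ 2 * (n%:R * sigma) <=
  2 * signal_energy U (fun k => 1 - s k) (values x f).
Proof.
have F_le : F <= 2 * signal_energy U (fun k => 1 - s k) (values x f) +
    2 * (\sum_k s k ^+ 2 * g k 0 ^+ 2).
  rewrite /signal_energy !mulr_sumr -big_split /= ler_sum// => k _.
  rewrite -/g; have := sqr_ge0 ((1 - 2 * s k) * g k 0); lra.
have ne : 0 <= n%:R / eta by rewrite divr_ge0// ltW.
have := separation; rewrite mulrDr => sp.
have := shrink_bias; have := ler_wpM2r ne (ltW CeC); lra.
Qed.

(** If eta muhat_k <= 1 for all k, then n ||f||_n^2 <= C^2 n / eta contradicts
the separation. Hence some muhat_k exceeds 1 / eta, and then q_k >= 1/2 already
makes the trace of the fourth power at least 1/16. *)
Lemma sd_H0_lower_bound : 1 <= 4 * (n%:R * sigma).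
Proof.
have [k mk] : exists k, 1 < eta * muhat 0 k.
  apply: contrapT => /forallNP Hk.
  have F_le : F <= C ^+ 2 * (n%:R / eta).
    rewrite (_ : F = \sum_k 1 ^+ 2 * g k 0 ^+ 2).
      apply: (@biasE _ (fun=> 1)) => [|k]; first by rewrite invr_ge0 ltW.
      rewrite expr1n mulr1 -[leRHS]mul1r ler_pdivlMr// mulrC leNgt.
      by apply/negP; exact: Hk.
    by apply: eq_bigr => k _; rewrite expr1n mul1r.
  have ne : 0 < n%:R / eta by rewrite divr_gt0.
  have s0 : 0 <= Ce ^+ 2 * (n%:R * sigma).
    by rewrite mulr_ge0 ?sqr_ge0// mulr_ge0// sqrtr_ge0.
  have := separation; rewrite mulrDr => sp.
  have CC : C ^+ 2 < Ce ^+ 2.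
    by apply: le_lt_trans CeC; rewrite ler_peMl ?sqr_ge0// ler1n.
  have : C ^+ 2 * (n%:R / eta) < Ce ^+ 2 * (n%:R / eta) by rewrite ltr_pM2r.
  lra.
have [s0 s1 sm] := shrink_factor_bounds t (fun tau => step tau k).
rewrite -/s in s0 s1 sm.
have s2 : s k <= 2^-1.
  have := ler_wpM2l s0 (ltW mk); lra.
have sig2 : (n%:R * sigma) ^+ 2 = 2 * \sum_k (1 - s k) ^+ 4.
  by rewrite exprMn sqr_sd_H0 mulrA mulrCA divff ?mulr1// expf_neq0// gt_eqF.
have qk : (2^-1) ^+ 4 <= (1 - s k) ^+ 4 by rewrite lerXn2r ?nnegrE; lra.
have : (2^-1) ^+ 4 <= \sum_k (1 - s k) ^+ 4.
  apply: (le_trans qk); rewrite (bigD1 k)//= lerDl.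
  by apply: sumr_ge0 => i _; rewrite exprn_even_ge0.
have y0 : 0 <= n%:R * sigma by rewrite mulr_ge0// sqrtr_ge0.
move=> sum_ge; rewrite leNgt; apply/negP => lt1.
have : (4 * (n%:R * sigma)) ^+ 2 < 1.
  by rewrite expr_lt1// mulr_ge0.
rewrite exprMn sig2; lra.
Qed.

End signal.

(** * Power of the test *)

(** Arithmetic of Chebyshev's inequality at the threshold X / 2. Here X is the
signal energy, Y stands for n sigma, and E for the squared separation constant.
Since Y is bounded below, X is at least E / 8, so X is at most 8 X^2 / E, while
Y^2 is at most 4 X^2 / E. *)
Lemma chebyshev_budget (R : realFieldType) (kap e E X Y : R) :
  0 < kap -> 0 < e -> 1 <= E -> 136 * kap / e <= E -> 1 <= 4 * Y ->
  E * Y <= 2 * X ->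
  kap * (4 * X + Y ^+ 2 / 2) <= e * (X / 2) ^+ 2.
Proof.
move=> kap0 e0 E1 kE Y1 EX.
have E0 : 0 < E by lra.
have kE' : 136 * kap <= E * e by rewrite -ler_pdivrMr.
have Y0 : 0 < Y by lra.
have X0 : 0 < X by have := mulr_gt0 E0 Y0; lra.
have X8 : E <= 8 * X by have := ler_wpM2l (ltW E0) Y1; lra.
have EXX : E * X <= 8 * X ^+ 2.
  by rewrite expr2 mulrA ler_wpM2r// ltW.
have EY2 : E * Y ^+ 2 <= 4 * X ^+ 2.
  have h1 : (E * Y) ^+ 2 <= (2 * X) ^+ 2.
    by rewrite lerXn2r// nnegrE mulr_ge0// ltW.
  apply: le_trans (_ : (2 * X) ^+ 2 <= _); last by rewrite exprMn -natrX.
  apply: le_trans h1; rewrite exprMn ler_wpM2r ?sqr_ge0// expr2 ler_peMl//.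
  exact: ltW.
rewrite -(ler_pM2l E0).
have step : kap * (E * (4 * X + Y ^+ 2 / 2)) <= kap * (34 * X ^+ 2).
  by rewrite ler_wpM2l ?(ltW kap0)//; lra.
have := ler_wpM2r (sqr_ge0 X) kE'.
by move: step; lra.
Qed.

Section power.
Context {R : realType} {d : nat}.
Local Notation E := (d.-tuple R).
Variables (XX : set E) (K : E -> E -> R) (H : set (E -> R))
  (ip : (E -> R) -> (E -> R) -> R).
Hypothesis HK : is_rkhs XX K H ip.
Context (dO : measure_display) (Omega : measurableType dO)
  (P : probability Omega R) (eps : nat -> {RV P >-> R}) (kap : R).
Hypothesis kap0 : 0 < kap.
Hypothesis tail : forall n (c : 'I_n -> R) (B : 'I_n -> 'I_n -> R) (r : R),
  0 < r -> (P [set w | (r <= `|noise_form eps c B w|)%R] <=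
  (kap * (\sum_i c i ^+ 2 + \sum_i \sum_j B i j ^+ 2) / r ^+ 2)%:E)%E.

Lemma wald_statistic n (x : 'I_n -> E) (U : 'M[R]_n) (muhat : 'rV[R]_n)
    (alpha : nat -> R) t f w :
  spectral_decomposition (kernel_mx K x) U muhat ->
  let q k := 1 - shrink_factor alpha muhat t k in
  emp_norm (gd_fit alpha (kernel_mx K x) (values x f + \col_i eps i w) t) ^+ 2
    - mean_H0 alpha muhat t =
  n%:R^-1 * (signal_energy U q (values x f) +
    noise_form eps (linear_weight U q (values x f)) (quadratic_weight U q) w).
Proof.
move=> [KE UU _ _] q.
rewrite sqr_emp_norm -(sum_sqr_orthogonal _ UU) mean_H0E -mulrBr.
congr (_ * _).
under eq_bigr do rewrite (gd_fit_coordinates _ _ _ _ KE UU).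
rewrite (quadratic_statistic_split q (values x f) UU (\col_i eps i w)).
congr (_ + _); rewrite /noise_form; congr (_ + _).
  by apply: eq_bigr => i _; rewrite mxE.
by apply: eq_bigr => i _; apply: eq_bigr => j _; rewrite !mxE.
Qed.

(** When the test accepts, the noise form must exceed half of the signal energy,
because the critical value is at most a quarter of Ce^2 sigma and hence at most
X / (2 n). *)
Lemma wald_power n (x : 'I_n -> E) (U : 'M[R]_n) (muhat : 'rV[R]_n)
    (alpha : nat -> R) t f (lev C Ce e : R) :
  (0 < n)%N -> (forall i, XX (x i)) ->
  spectral_decomposition (kernel_mx K x) U muhat ->
  (forall tau k, 0 <= alpha tau * muhat 0 k <= 1) ->
  0 < total_step alpha t -> 0 <= C -> 0 < e -> 0 <= Ce ->
  1 + 2 * C ^+ 2 + 4 * `|normal_percentile (1 - lev / 2)| + 136 * kap / e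
    <= Ce ^+ 2 ->
  H f -> rkhs_norm ip f <= C ->
  Ce * sep_rate alpha muhat t <= emp_norm (values x f) ->
  ((1 - e)%:E <= cond_power eps alpha lev K x muhat f t)%E.
Proof.
move=> n0 Xx spec step eta0 C0 e0 Ce0 CeE Hf fC sep.
have nR : 0 < n%:R :> R by rewrite ltr0n.
set z := normal_percentile _ in CeE.
have C2 := sqr_ge0 C; have z0 := normr_ge0 z.
have ke0 : 0 <= 136 * kap / e by rewrite divr_ge0 ?mulr_ge0// ltW.
have CeC : 2 * C ^+ 2 < Ce ^+ 2 by lra.
pose q k := 1 - shrink_factor alpha muhat t k.
pose v := values x f.
set sg := sd_H0 alpha muhat t.
have s0 : 0 <= sg by exact: sqrtr_ge0.
have EX : Ce ^+ 2 * (n%:R * sg) <= 2 * signal_energy U q v.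
  exact: (signal_energy_bound HK n0 Xx spec step eta0 Hf C0 fC Ce0 sep CeC).
have Y1 : 1 <= 4 * (n%:R * sg).
  exact: (sd_H0_lower_bound HK n0 Xx spec step eta0 Hf C0 fC Ce0 sep CeC).
set X := signal_energy U q v in EX *.
have X0 : 0 < X.
  have : 0 < Ce ^+ 2 * (n%:R * sg) by rewrite mulr_gt0; lra.
  lra.
pose Z := noise_form eps (linear_weight U q v) (quadratic_weight U q).
pose W := [set w | wald_test alpha muhat lev (kernel_mx K x) t
               (v + \col_i eps i w)].
have WE : W = [set w | z * sg <= `|n%:R^-1 * (X + Z w)|].
  by apply/seteqP; split => w;
    rewrite /W /= /wald_test (wald_statistic _ _ _ _ spec).
have mZ : measurable_fun setT Z by exact: measurable_noise_form.
have mW : measurable W.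
  rewrite WE -[X in measurable X]setTI; apply: measurable_fun_le => //.
  apply: measurableT_comp => //; apply: measurable_funM => //.
  exact: measurable_funD.
rewrite /cond_power -/W.
have sub : ~` W `<=` [set w | X / 2 <= `|Z w|].
  move=> w /=; rewrite WE /= => /negP; rewrite -ltNge => lt1.
  rewrite leNgt; apply/negP => lt2; move: lt1; apply/negP; rewrite -leNgt.
  apply: (@le_trans _ _ (`|z| * sg)); first by rewrite ler_wpM2r// ler_norm.
  apply: le_trans (ler_norm _); rewrite ler_pdivlMl//.
  have : 4 * `|z| * (n%:R * sg) <= Ce ^+ 2 * (n%:R * sg).
    by rewrite ler_wpM2r ?mulr_ge0//; lra.
  have := ler_norm (- Z w); rewrite normrN; lra.
have q01 k : 0 <= q k <= 1.
  have [? ? _] := shrink_factor_bounds t (fun tau => step tau k).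
  by rewrite /q; apply/andP; split; lra.
have [_ UU _ _] := spec.
have PW : (P (~` W) <= e%:E)%E.
  have X20 : 0 < X / 2 by rewrite divr_gt0.
  have tailX := tail (linear_weight U q v) (quadratic_weight U q) X20.
  apply: le_trans (le_trans _ tailX) _.
    apply: le_measure => //; rewrite inE; first exact: measurableC.
    rewrite -[X in measurable X]setTI; apply: measurable_fun_le => //.
    exact: measurableT_comp.
  rewrite lee_fin ler_pdivrMr ?exprn_gt0//.
  have budget : kap * (4 * X + (n%:R * sg) ^+ 2 / 2) <= e * (X / 2) ^+ 2.
    by apply: (@chebyshev_budget _ kap e (Ce ^+ 2)) => //; lra.
  apply: le_trans budget.
  rewrite ler_wpM2l ?(ltW kap0)// lerD//; first exact: sum_sqr_linear_weight.
  rewrite (sum_sqr_quadratic_weight q UU) exprMn sqr_sd_H0 -/q.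
  rewrite le_eqVlt; apply/orP; left; apply/eqP; field.
  by rewrite gt_eqF.
rewrite -[W]setCK probability_setC; last exact: measurableC.
by rewrite EFinB leeB.
Qed.
End power.

(** * The stopping rule *)

Section stopping.
Context {R : realType} (alpha : nat -> R).
Hypotheses (alpha_ge0 : forall s, 0 <= alpha s)
  (alpha_noninc : forall s t, (s <= t)%N -> alpha t <= alpha s)
  (eta_infty : total_step alpha t @[t --> \oo] --> +oo).
Local Notation eta := (total_step alpha).

Lemma total_stepS t : eta t.+1 = eta t + alpha t.
Proof. by rewrite /total_step big_ord_recr. Qed.

Lemma total_step_nondecreasing s t : (s <= t)%N -> eta s <= eta t.
Proof.
move=> /subnKC <-; elim: (t - s)%N => [|k IH]; first by rewrite addn0.
by rewrite addnS total_stepS (le_trans IH)// lerDl.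
Qed.

Lemma total_step_gt A : exists t, A < eta t.
Proof.
by have /cvgryPgt/(_ A)[N _ /(_ N (leqnn N))] := eta_infty; exists N.
Qed.

(** A first step of size 0 would force all steps to be 0, against the divergence
of the total step size. *)
Lemma total_step_gt0 t : (0 < t)%N -> 0 < eta t.
Proof.
move=> t0; suff a0 : 0 < alpha 0%N.
  apply: lt_le_trans (total_step_nondecreasing t0).
  by rewrite total_stepS /total_step big_ord0 add0r.
rewrite lt_neqAle eq_sym alpha_ge0 andbT; apply/eqP => a0.
have [u] := total_step_gt 0; rewrite /total_step big1 ?ltxx// => i _.
by apply/eqP; rewrite eq_le alpha_ge0 andbT -a0 alpha_noninc.
Qed.

(** The step alpha_t is at most the first step, which is part of eta_t. *)
Lemma total_step_double t : (0 < t)%N -> eta t.+1 <= 2 * eta t.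
Proof.
move=> t0; rewrite total_stepS mulr_natl mulr2n lerD2l.
apply: le_trans (total_step_nondecreasing t0).
by rewrite total_stepS /total_step big_ord0 add0r alpha_noninc.
Qed.

Section rate.
Context {n : nat} (muhat : 'rV[R]_n).
Hypothesis mu0 : forall k, 0 <= muhat 0 k.
Local Notation comp := (complexity alpha muhat).
Local Notation ord := (sep_rate_order alpha muhat).

Lemma complexity_ge0 t : 0 <= comp t.
Proof. by rewrite mulr_ge0 ?invr_ge0 ?sqrtr_ge0. Qed.

Lemma complexity_le s t : eta s <= eta t -> comp s <= comp t.
Proof.
move=> st; rewrite ler_wpM2l ?invr_ge0// ler_wsqrtr// ler_sum// => k _.
rewrite le_min ge_min lexx /= ge_min; apply/orP; right.
by rewrite ler_wpM2r.
Qed.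

Lemma complexity_double t : (0 < t)%N -> comp t.+1 <= 2 * comp t.
Proof.
move=> t0; rewrite /complexity mulrCA ler_wpM2l ?invr_ge0//.
rewrite -[2](@ger0_norm R)// -sqrtr_sqr -sqrtrM ?sqr_ge0// ler_wsqrtr//.
rewrite mulr_sumr ler_sum// => k _.
have e1 := total_step_double t0; have e0 := total_step_gt0 t0.
have h1 : eta t.+1 * muhat 0 k <= 2 * (eta t * muhat 0 k).
  by rewrite mulrA ler_wpM2r.
have h0 : 0 <= eta t * muhat 0 k by rewrite mulr_ge0// ltW.
rewrite /Num.min; case: ifPn; case: ifPn; rewrite -?leNgt => *; lra.
Qed.

Lemma sqr_sep_rate_order t : ord t ^+ 2 = (eta t)^-1 + comp t.
Proof.
rewrite sqr_sqrtr// addr_ge0 ?complexity_ge0// invr_ge0 /total_step.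
exact: sumr_ge0.
Qed.

Lemma stopping_rule_ex :
  (0 < n)%N -> (exists k, 0 < muhat 0 k) ->
  exists T, is_minimum (stopping_rule alpha muhat) T.
Proof.
move=> n0 [k mk]; have nR : 0 < n%:R :> R by rewrite ltr0n.
have [t] := total_step_gt (Num.max n%:R (muhat 0 k)^-1).
rewrite gt_max => /andP[nt mt].
have et : 0 < eta t by exact: lt_trans nt.
have Pt : `[< stopping_rule alpha muhat t >].
  apply/asboolP; rewrite /stopping_rule /= /noise_sd mul1r.
  apply: (@lt_le_trans _ _ n%:R^-1); first by rewrite ltf_pV2.
  rewrite /complexity ler_peMr ?invr_ge0// -[leLHS]sqrtr1 ler_wsqrtr//.
  rewrite (bigD1 k)//= -[leLHS]addr0; apply: lerD.
    by rewrite le_min lexx /= -ler_pdivrMr// div1r ltW.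
  by apply: sumr_ge0 => i _; rewrite le_min ler01 mulr_ge0// ltW.
have ex : exists u, `[< stopping_rule alpha muhat u >] by exists t.
have [T /asboolP PT minT] := ex_minnP ex.
by exists T; split => // j Pj; apply: minT; apply/asboolP.
Qed.

Lemma stopping_rule_gt0 T : stopping_rule alpha muhat T -> (0 < T)%N.
Proof.
rewrite /stopping_rule /= /noise_sd mul1r.
case: T => //; rewrite /complexity /total_step big_ord0 invr0.
by rewrite big1 ?sqrtr0 ?mulr0 ?ltxx// => i _; rewrite mul0r minEle ler10.
Qed.

(** For t >= T the complexity at t is at least the complexity at T, which
dominates 1 / eta_T. For t < T the rule fails at T - 1, so the complexity at T
is at most twice 1 / eta_(T-1), hence at most twice 1 / eta_t. *)
Lemma sep_rate_order_minimal T t :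
  is_minimum (stopping_rule alpha muhat) T -> (0 < t)%N -> ord T <= 2 * ord t.
Proof.
move=> [PT minT] t0; have T0 := stopping_rule_gt0 PT.
move: PT; rewrite /stopping_rule /= /noise_sd mul1r => PT.
suff : ord T ^+ 2 <= (2 * ord t) ^+ 2.
  by rewrite ler_sqr// nnegrE ?mulr_ge0 ?sqrtr_ge0.
rewrite exprMn !sqr_sep_rate_order.
have et := total_step_gt0 t0; have eT := total_step_gt0 T0.
have it : 0 < (eta t)^-1 by rewrite invr_gt0.
have c0 := complexity_ge0 t.
have [Tt|tT] := leqP T t.
  have := complexity_le (total_step_nondecreasing Tt); lra.
have : (eta T)^-1 <= (eta t)^-1.
  by rewrite lef_pV2// total_step_nondecreasing// ltnW.
have TE : T = T.-1.+1 by rewrite prednK.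
have tT1 : (t <= T.-1)%N by rewrite -ltnS -TE.
have T10 : (0 < T.-1)%N by exact: leq_trans tT1.
have : comp T.-1 <= (eta T.-1)^-1.
  rewrite leNgt; apply/negP => PT1.
  have : stopping_rule alpha muhat T.-1 by rewrite /stopping_rule /= mul1r.
  by move=> /minT; rewrite {1}TE ltnn.
have : (eta T.-1)^-1 <= (eta t)^-1.
  by rewrite lef_pV2 ?posrE ?total_step_gt0// total_step_nondecreasing.
have := complexity_double T10; rewrite -TE.
lra.
Qed.

End rate.
End stopping.

(** * Uniform power and minimal separation rate *)

Theorem theorem3p3 (R : realType) (d : nat) (d_gt0 : (0 < d)%N)
  (dO : measure_display) (Omega : measurableType dO) (P : probability Omega R)
  (XX : set (d.-tuple R)) (mXX : measurable XX)
  (PX : probability (d.-tuple R) R)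
  (X : nat -> {RV P >-> d.-tuple R}) (eps : nat -> {RV P >-> R})
  (X_in : forall i w, XX (X i w))
  (Xeps : random_design PX X eps)
  (K : d.-tuple R -> d.-tuple R -> R)
  (H : set (d.-tuple R -> R))
  (ip : (d.-tuple R -> R) -> (d.-tuple R -> R) -> R)
  (H_rkhs : is_rkhs XX K H ip) (H_L2 : subset_L2 XX PX H)
  (mu : nat -> R) (phi : nat -> d.-tuple R -> R)
  (K_mercer : is_mercer_expansion XX PX K H ip mu phi)
  (cK : R) (cK_gt0 : 0 < cK)
  (phi_bounded : forall j x, XX x -> `|phi j x| <= cK)
  (U : forall n, Omega -> 'M[R]_n) (muhat : forall n, Omega -> 'rV[R]_n)
  (K_spectral : forall n w,
     spectral_decomposition (kernel_mx K (design X n w)) (U n w) (muhat n w))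
  (lev : R) (lev_gt0 : 0 < lev) (lev_lt1 : lev < 1)
  (C : R) (C_gt0 : 0 < C)
  (alpha : nat -> R)
  (alpha_noninc : forall s t, (s <= t)%N -> alpha t <= alpha s)
  (alpha_adm : {ae P, forall w, forall n, (0 < n)%N -> forall tau,
     admissible_step (muhat n w) (alpha tau)})
  (eta_infty : total_step alpha t @[t --> \oo] --> +oo)
  (eta_negl : preserves_negligibility alpha) :
  (* (a) *)
  (kappa alpha mu t @[t --> \oo] --> \oo ->
   exists2 c : R, 0 < c & forall e : R, 0 < e ->
   exists (Ce : R) (te Ne : nat), [/\ 0 < Ce, (0 < te)%N, (0 < Ne)%N &
     forall t0, (te <= t0)%N ->
     exists G : set Omega, [/\ measurable G,
       ((1 - expR (- (c * (kappa alpha mu t0)%:R)))%:E < P G)%E &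
       forall w, G w -> forall t, (te <= t)%N -> forall n, (Ne <= n)%N ->
       forall f, H f -> rkhs_norm ip f <= C ->
         Ce * sep_rate alpha (muhat n w) t
           <= emp_norm (values (design X n w) f) ->
         ((1 - e)%:E <= cond_power eps alpha lev K (design X n w)
                          (muhat n w) f t)%E]])
  /\
  (* (b): T* exists as soon as the empirical kernel matrix is nonzero, and the
     rate at T* is minimal up to a constant, both for the order of the rate and
     for the rate itself when the two are comparable *)
  [/\ forall (w : Omega) n, (0 < n)%N -> kernel_mx K (design X n w) != 0 ->
        exists T, is_minimum (stopping_rule alpha (muhat n w)) T,
      exists2 M : R, 0 < M &
        forall (w : Omega) n T, (0 < n)%N ->
          is_minimum (stopping_rule alpha (muhat n w)) T ->
          forall t, (0 < t)%N ->
            sep_rate_order alpha (muhat n w) T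
              <= M * sep_rate_order alpha (muhat n w) t &
      forall a b : R, 0 < a -> 0 < b ->
      exists2 M : R, 0 < M &
        forall (w : Omega) n T, (0 < n)%N ->
          (forall t, (0 < t)%N ->
             a * sep_rate_order alpha (muhat n w) t ^+ 2
               <= sep_rate alpha (muhat n w) t ^+ 2
               <= b * sep_rate_order alpha (muhat n w) t ^+ 2) ->
          is_minimum (stopping_rule alpha (muhat n w)) T ->
          forall t, (0 < t)%N ->
            sep_rate alpha (muhat n w) T <= M * sep_rate alpha (muhat n w) t].
Proof.
have [A [mA PA0 subA]] := alpha_adm.
have adm w : ~ A w -> forall n, (0 < n)%N -> forall tau,
    admissible_step (muhat n w) (alpha tau).
  move=> NAw; apply: contrapT => Nadm; exact/NAw/subA.
have PG : P (~` A) = 1%E by rewrite probability_setC// PA0 sube0.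
have alpha_ge0 s : 0 <= alpha s.
  have [w NAw] : exists w, ~ A w.
    apply: contrapT => /forallNP all.
    have : P (~` A) = 0%E.
      rewrite (_ : ~` A = set0) ?measure0//.
      by apply/seteqP; split => w // /all.
    by rewrite PG => /eqP; rewrite eqe oner_eq0.
  by have [] := adm w NAw 1%N isT s.
have mu0 n w k : 0 <= muhat n w 0 k by have [] := K_spectral n w.
have [_ eps_law XE_indep] := Xeps.
split; last first.
  split.
  - move=> w n n0 K0; apply: stopping_rule_ex => //.
    apply: contrapT => /forallNP all; case/eqP: K0.
    have [-> _ _ _] := K_spectral n w.
    rewrite (_ : muhat n w = 0) ?linear0 ?mulmx0 ?mul0mx//.
    apply/matrixP => i k; rewrite ord1 mxE; apply/eqP.
    by rewrite eq_le mu0 andbT leNgt; apply/negP.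
  - exists 2 => // w n T n0 PT t t0; exact: sep_rate_order_minimal.
  - move=> a b a0 b0; exists (2 * Num.sqrt (b / a)).
      by rewrite mulr_gt0// sqrtr_gt0 divr_gt0.
    move=> w n T n0 ab PT t t0.
    have T0 : (0 < T)%N by case: PT => /stopping_rule_gt0.
    have /andP[_ leT] := ab T T0; have /andP[let_ _] := ab t t0.
    have ordT := sep_rate_order_minimal alpha_ge0 alpha_noninc eta_infty
      (mu0 n w) PT t0.
    have ba : Num.sqrt (b / a) ^+ 2 = b / a.
      by rewrite sqr_sqrtr// ltW// divr_gt0.
    rewrite -ler_sqr ?nnegrE ?mulr_ge0 ?sqrtr_ge0//.
    apply: (le_trans leT); rewrite !exprMn ba.
    have ord2 : sep_rate_order alpha (muhat n w) T ^+ 2 <=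
        4 * sep_rate_order alpha (muhat n w) t ^+ 2.
      rewrite (_ : 4 = 2 ^+ 2); last by ring.
      by rewrite -exprMn ler_sqr ?nnegrE ?mulr_ge0 ?sqrtr_ge0.
    apply: (le_trans (ler_wpM2l (ltW b0) ord2)).
    rewrite (_ : 2 ^+ 2 * (b / a) * _ = b * (4 * (a^-1 *
      sep_rate alpha (muhat n w) t ^+ 2))); last by ring.
    by rewrite ler_wpM2l ?(ltW b0)// ler_wpM2l// ler_pdivlMl.
move=> _; exists 1 => // e e0.
have eps_indep m (B : nat -> set R) : (forall i, measurable (B i)) ->
    (P [set w | forall i, (i < m)%N -> B i (eps i w)] =
     \prod_(i < m) P (eps i @^-1` B i))%E.
  move=> mB; have := XE_indep m (fun=> setT) B (fun=> measurableT) mB.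
  rewrite (_ : [set w | _] = [set w | forall i, (i < m)%N -> B i (eps i w)]).
    move=> ->; apply: eq_bigr => i _.
    by rewrite preimage_setT probability_setT mul1e.
  apply/seteqP; split => w /= Bw i im; first by case: (Bw i im).
  by split => //; exact: Bw.
have [gam [V [V1 gamP gam0 gam_le]]] := @normal_hermite_moments R.
have V0 : 0 < V by exact: lt_le_trans V1.
pose kap := 3 * V ^+ 2.
have kap0 : 0 < kap by rewrite mulr_gt0// exprn_gt0.
have tail m (c : 'I_m -> R) (B : 'I_m -> 'I_m -> R) (r : R) : 0 < r ->
    (P [set w | (r <= `|noise_form eps c B w|)%R] <=
    (kap * (\sum_i c i ^+ 2 + \sum_i \sum_j B i j ^+ 2) / r ^+ 2)%:E)%E.
  exact: (noise_form_tail eps_law eps_indep V1 gamP gam0 gam_le).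
(* 2 C^2 absorbs the bias, 4 |z| the critical value and 136 kap / e the noise *)
pose E := 1 + 2 * C ^+ 2 + 4 * `|normal_percentile (1 - lev / 2)|
  + 136 * kap / e.
have E1 : 1 <= E.
  have ke0 : 0 <= 136 * kap / e.
    exact: divr_ge0 (mulr_ge0 _ (ltW kap0)) (ltW e0).
  rewrite /E -!addrA lerDl; apply: addr_ge0; first by rewrite mulr_ge0 ?sqr_ge0.
  exact: addr_ge0 ke0.
exists (Num.sqrt E), 1%N, 1%N; split => //.
  by rewrite sqrtr_gt0 (lt_le_trans _ E1).
move=> t0 _; exists (~` A); split.
- exact: measurableC.
- by rewrite PG lte_fin ltrBlDr ltrDl expR_gt0.
move=> w NAw t t1 n n1 f Hf fC sep.
apply: (wald_power H_rkhs kap0 tail n1 _ (K_spectral n w) _ _ (ltW C_gt0) e0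
  _ _ Hf fC sep) => //.
- by move=> i; exact: X_in.
- move=> tau k; have [a0 _ a1] := adm w NAw n n1 tau.
  have [_ _ mu_noninc _] := K_spectral n w.
  rewrite mulr_ge0//=; apply: le_trans (a1 (Ordinal n1) erefl).
  by rewrite ler_wpM2l// mu_noninc.
- exact: total_step_gt0.
- by rewrite sqr_sqrtr// (le_trans _ E1).
Qed.
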